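(* Let $G$ be a Lie group (in Milnor's sense, modeled over a Hausdorff locally convex vector space) that is $k$-continuous for some $k\in\mathbb N\sqcup\{\mathrm{lip},\infty\}$. Let $[r,r']$ be a compact interval, and suppose that $(-\delta,\delta)\cdot\phi\subseteq\mathfrak D^k_{[r,r']}$ holds for some $\phi\in C^k([r,r'],\mathfrak g)$ and $\delta>0$. Then $$\frac{d}{dh}\Big|_{h=0}\mathrm{evol}^k_{[r,r']}(h\cdot\phi)=\int_r^{r'}\phi(s)\,ds\ \in\ \overline{\mathfrak g}.$$ Thus the directional derivative of $\mathrm{evol}^k_{[r,r']}$ at zero along such a $\phi$ always exists, namely in the completion $\overline{\mathfrak g}$ of $\mathfrak g$.
   Context: Calculus: for Hausdorff locally convex vector spaces $F,E$ and $U\subseteq F$ open, a map $f:U\to E$ is differentiable at $x$ if $D_vf(x)=\lim_{t\to 0}\frac1t(f(x+tv)-f(x))$ exists in $E$ for every $v\in F$; it is $C^0$ if continuous, $C^k$ ($k\ge 1$) if all iterated directional derivatives $D_{v_p}\cdots D_{v_1}f$ ($p\le k$) exist and $(x,v_1,\dots,v_p)\mapsto D_{v_p}\cdots D_{v_1}f(x)$ is continuous on $U\times F^p$ for $0\le p\le k$; $C^\infty$ (smooth) if $C^k$ for all $k$. $G$ is a Lie group in Milnor's sense: a group that is a smooth Hausdorff manifold (in this calculus) modeled on a Hausdorff locally convex vector space $E$, with smooth multiplication and inversion. $e$ is the unit, $\mathfrak g=T_eG$ the Lie algebra, $\mathrm R_g(h)=hg$. $\mathfrak P$ is the set of continuous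 seminorms on $E$. $\Xi:G\supseteq\mathcal U\to\mathcal V\subseteq E$ is a fixed chart with $e\in\mathcal U$, $\Xi(e)=0$, $\mathcal V$ convex. For $\mathfrak p\in\mathfrak P$ put $\dot{\mathfrak p}:=\mathfrak p\circ d_e\Xi$; these seminorms define the topology of $\mathfrak g$. $\overline{\mathfrak g},\overline E$ denote completions; $d_e\Xi$ extends to an isomorphism $\overline{d_e\Xi}:\overline{\mathfrak g}\to\overline E$. Riemann integrals of continuous $\mathfrak g$-valued curves are taken in $\overline{\mathfrak g}$. For a $G$-valued map $h\mapsto g(h)$ defined near $0$ with $g(0)=e$, the formula $\frac{d}{dh}|_{h=0}g(h)=Z\in\overline{\mathfrak g}$ means that $\lim_{h\to0}\frac1h\Xi(g(h))$ exists in $\overline E$ and equals $\overline{d_e\Xi}(Z)$. A curve on $[r,r']$ ($r<r'$) is $C^k$, $k\in\mathbb N\sqcup\{\infty\}$, if it is the restriction of a $C^k$-curve on an open interval containing $[r,r']$; $C^{\mathrm{lip}}([r,r'],\mathfrak g)$ is the set of curves $\phi$ such that for each $\mathfrak p\in\mathfrak P$ there is $L_{\mathfrak p}\ge0$ with $\dot{\mathfrak p}(\phi(t)-\phi(t'))\le L_{\mathfrak p}|t-t'|$ for all $t,t'$. For $s\in\mathbb N$ write $s\preceq k$ if: $s\le k$ when $k\in\mathbb N$; $s=0$ when $k=\mathrm{lip}$; $s$ arbitrary when $k=\infty$. The $C^k$-topology on $C^k([r,r'],\mathfrak g)$ is generated by the seminorms $\dot{\mathfrak p}^s_\infty(\phi):=\sup\{\dot{\mathfrak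 p}(\phi^{(m)}(t)):0\le m\le s,\ t\in[r,r']\}$ with $\mathfrak p\in\mathfrak P$, $s\preceq k$. The right logarithmic derivative of $\mu\in C^1([r,r'],G)$ is $\delta^r(\mu)(t)=d_{\mu(t)}\mathrm R_{\mu(t)^{-1}}(\dot\mu(t))$. Put $\mathfrak D^k_{[r,r']}:=\delta^r(C^1([r,r'],G))\cap C^k([r,r'],\mathfrak g)$, and $\mathrm{evol}^k_{[r,r']}:\mathfrak D^k_{[r,r']}\to G$, $\delta^r(\mu)\mapsto\mu(r')\mu(r)^{-1}$ (well defined). $G$ is $k$-continuous if $\mathrm{evol}^k_{[r,r']}$ is continuous with respect to the subspace $C^k$-topology on $\mathfrak D^k_{[r,r']}$ for every compact interval $[r,r']$. *)

(* Defs.v *)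
From HB Require Import structures.
From mathcomp Require Import all_boot all_order all_algebra.
From mathcomp Require Import all_classical all_reals.
From mathcomp Require Import interval_inference topology normedtype tvs convex.

(* Lie groups in Milnor's sense, modelled on Hausdorff locally convex spaces  *)
(* [tvsType R], and their evolution maps. The limits of difference quotients  *)
(* below are meaningful for Hausdorff targets only, and the sets on which maps *)
(* are differentiated are meant to be open.                                   *)

Set Implicit Arguments.
Unset Strict Implicit.
Unset Printing Implicit Defensive.
Import Order.TTheory GRing.Theory Num.Theory.
Import numFieldNormedType.Exports.
Local Open Scope classical_set_scope.
Local Open Scope ring_scope.

Section Calculus.
Context {R : realType} {F E : tvsType R}.
Implicit Types (f : F -> E) (U : set F).

Definition diffquot f (x v : F) (t : R) : E := t^-1 *: (f (x + t *: v) - f x).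

Definition has_dirderiv f x v (w : E) := diffquot f x v t @[t --> 0^'] --> w.

Definition dirderiv (v : F) f (x : F) : E :=
  xget 0 [set w | has_dirderiv f x v w].

(* D_{v_p} ... D_{v_1} f for vs = [:: v_1; ...; v_p]                          *)
Definition dirderivs (vs : seq F) f : F -> E :=
  foldl (fun g v => dirderiv v g) f vs.

(* f is C^k on the open set U. As U is open, continuity on U `*` F^p is       *)
(* continuity at each of its points.                                          *)
Definition isC (k : nat) U f :=
  (forall x vs v, U x -> (size vs < k)%N ->
     exists w, has_dirderiv (dirderivs vs f) x v w) /\
  (forall p x (v : {ptws 'I_p -> F}), (p <= k)%N -> U x ->
     {for (x, v), continuous (fun z : F * {ptws 'I_p -> F} =>
                     dirderivs [seq z.2 i | i : 'I_p] f z.1)}).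

Definition isCinf U f := forall k, isC k U f.

End Calculus.

Section CalculusFacts.
Context {R : realType}.

Lemma cvg_diffquot_unique (F E : tvsType R) (f : F -> E) x v w :
  hausdorff_space E -> has_dirderiv f x v w -> dirderiv v f x = w.
Proof.
move=> hE fw; apply: (xget_unique _ fw) => w'.
by move=> fw'; exact: (cvg_unique hE fw' fw).
Qed.

Lemma dirderivP (F E : tvsType R) (f : F -> E) x v :
  (exists w, has_dirderiv f x v w) -> has_dirderiv f x v (dirderiv v f x).
Proof. by move=> fw; exact: (xgetPex 0 fw). Qed.


Lemma cvgD_tvs (E : tvsType R) T (Fl : set_system T) {FF : Filter Fl}
  (a b : T -> E) (x y : E) :
  a @ Fl --> x -> b @ Fl --> y -> a t + b t @[t --> Fl] --> x + y.
Proof.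
exact: (@continuous2_cvg _ _ _ _ _ _ _ _ _ _ _ (@add_continuous E (x, y))).
Qed.

Lemma cvgZ_tvs (E : tvsType R) T (Fl : set_system T) {FF : Filter Fl}
  (k : T -> R) (b : T -> E) (x : R) (y : E) :
  k @ Fl --> x -> b @ Fl --> y -> k t *: b t @[t --> Fl] --> x *: y.
Proof.
move=> kx bY.
have h : (fun t => (k t : R^o, b t)) @ Fl --> ((x : R^o), y).
  by apply: (@cvg_pair _ _ _ Fl (nbhs (x : R^o)) (nbhs y)); [exact: kx|exact: bY].
exact: (cvg_comp _ _ h (@scale_continuous R E (x, y))).
Qed.

Lemma cvg_line (F : tvsType R) (x v : F) : x + t *: v @[t --> (0 : R)] --> x.
Proof.
rewrite -[X in _ --> X]addr0 -[X in _ --> _ + X](scale0r v).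
by apply: cvgD_tvs; [exact: cvg_cst|apply: cvgZ_tvs; [exact: cvg_id|exact: cvg_cst]].
Qed.

Lemma near_dirderiv (F E : tvsType R) (f g : F -> E) x v w :
  (\forall y \near x, f y = g y) -> has_dirderiv f x v w -> has_dirderiv g x v w.
Proof.
move=> fg; apply: cvg_trans; apply: near_eq_cvg.
have fgx := nbhs_singleton fg.
have := @cvg_line F x v _ fg; rewrite /fmap /= => h.
have {}h := nbhs_dnbhs h; apply: filterS h => t /= h.
by rewrite /diffquot h fgx.
Qed.

Lemma near_dirderivE (F E : tvsType R) (f g : F -> E) x v :
  (\forall y \near x, f y = g y) -> dirderiv v f x = dirderiv v g x.
Proof.
move=> fg; rewrite /dirderiv; congr xget; apply/seteqP; split => w /=.
  exact: near_dirderiv.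
by apply: near_dirderiv; apply: filterS fg => y ->.
Qed.

Lemma convex_setP (E : tvsType R) (C : set E) (x y : E) (a b : R) :
  convex_set C -> 0 <= a -> 0 <= b -> a + b = 1 -> C x -> C y ->
  C (a *: x + b *: y).
Proof.
move=> cC a0 b0 ab Cx Cy.
have a1 : a <= 1 by rewrite -ab lerDl.
have ha : Itv.spec (@Itv.num_sem R) (Itv.Real `[0%Z, 1%Z]) a.
  by rewrite /Itv.spec /= /Itv.num_sem /= in_itv /= a0 a1 ger0_real.
have := cC x y (Itv.mk ha) (mem_set Cx) (mem_set Cy).
move/set_mem; have <- : 1 - a = b by rewrite -ab [a + b]addrC addrK.
exact.
Qed.

Lemma convex_slope (E : tvsType R) (C : set E) (x y : E) (a b : R) :
  convex_set C -> 0 < a -> 0 < b -> C (a^-1 *: x) -> C (b^-1 *: y) ->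
  C ((a + b)^-1 *: (x + y)).
Proof.
move=> cC a0 b0 Cx Cy.
have ab0 : 0 < a + b by rewrite addr_gt0.
have -> : (a + b)^-1 *: (x + y) =
    (a / (a + b)) *: (a^-1 *: x) + (b / (a + b)) *: (b^-1 *: y).
  rewrite !scalerA ![_ / (a + b)]mulrC -!mulrA !divff ?gt_eqF// !mulr1.
  by rewrite scalerDr.
apply: convex_setP => //; [by rewrite divr_ge0// ltW|by rewrite divr_ge0// ltW|].
by rewrite -mulrDl divff// gt_eqF.
Qed.

Lemma convex_mean_value (E : tvsType R) (C : set E) (u : R -> E) :
  convex_set C -> open C ->
  (forall s, 0 <= s <= 1 ->
    exists2 w, C w & h^-1 *: (u (s + h) - u s) @[h --> 0^'] --> w) ->
  C (u 1 - u 0).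
Proof.
move=> cC oC du.
have loc s : 0 <= s <= 1 -> exists2 e : R, 0 < e &
    forall h, h != 0 -> `|h| < e -> C (h^-1 *: (u (s + h) - u s)).
  move=> /du[w Cw] /(_ C (open_nbhs_nbhs (conj oC Cw))) /=.
  rewrite /fmap /= => /nbhs_ballP[e /= e0 He]; exists e => // h h0 he.
  by apply: He => //=; rewrite /ball /= sub0r normrN.
pose S := [set s | 0 < s <= 1 /\ C (s^-1 *: (u s - u 0))].
have S0 : S !=set0.
  have [|e e0 He] := loc 0; first by rewrite lexx ler01.
  have m0 : 0 < Num.min (e / 2) 1 by rewrite lt_min ltr01 divr_gt0.
  exists (Num.min (e / 2) 1); split; first by rewrite m0 ge_min lexx orbT.
  have := He (Num.min (e / 2) 1); rewrite add0r; apply; first by rewrite gt_eqF.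
  by rewrite gtr0_norm// gt_min ltr_pdivrMr// ltr_pMr// ltr1n.
have uS : ubound S 1 by move=> s [/andP[]].
have hS : has_sup S by split => //; exists 1.
set sg := sup S.
have sg1 : sg <= 1 by apply: ge_sup.
have sg0 : 0 < sg.
  case: S0 => s Ss; case: (Ss) => /andP[s0 _] _.
  by apply: (lt_le_trans s0); apply: ub_le_sup => //; exists 1.
have [|e e0 He] := loc sg; first by rewrite sg1 ltW.
have Csg : C (sg^-1 *: (u sg - u 0)).
  have [s Ss ses] := sup_adherent e0 hS; case: (Ss) => /andP[s0 s1] Cs.
  have : s <= sg by apply: ub_le_sup => //; exists 1.
  rewrite le_eqVlt => /orP[/eqP <-//|ssg].
  have -> : sg = s + (sg - s) by rewrite addrC subrK.
  have -> : u (s + (sg - s)) - u 0 = (u s - u 0) + (u sg - u s).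
    by rewrite [s + _]addrC subrK [RHS]addrC addrA subrK.
  apply: convex_slope => //; first by rewrite subr_gt0.
  have := He (s - sg).
  have -> : sg + (s - sg) = s by rewrite addrC subrK.
  rewrite subr_eq0 lt_eqF//.
  rewrite -opprB normrN gtr0_norm ?subr_gt0// invrN scaleNr -scalerN opprB.
  by apply=> //; rewrite ltrBlDr -ltrBlDl.
have [sgE|] := eqVneq sg 1.
  by move: Csg; rewrite sgE invr1 scale1r.
rewrite neq_lt => /orP[slt1|]; last by rewrite ltNge sg1.
pose h := Num.min (e / 2) (1 - sg).
have h0 : 0 < h by rewrite lt_min subr_gt0 slt1 divr_gt0.
have : S (sg + h).
  split; first by rewrite addr_gt0//= -lerBrDl ge_min lexx orbT.
  have -> : u (sg + h) - u 0 = (u sg - u 0) + (u (sg + h) - u sg).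
    by rewrite [RHS]addrC addrA subrK.
  apply: convex_slope => //; apply: He; first by rewrite gt_eqF.
  by rewrite gtr0_norm// gt_min ltr_pdivrMr// ltr_pMr// ltr1n.
move=> /(ub_le_sup (ex_intro _ 1 uS)); rewrite -/sg gerDl leNgt h0//.
Qed.

Lemma tvs_convex_nbhs (E : tvsType R) (x : E) (W : set E) : nbhs x W ->
  exists C : set E, [/\ convex_set C, open C, C x & C `<=` W].
Proof.
move=> xW; have [B cB [oB bB]] := @locally_convex R E.
have [C [BC Cx] CW] := bB x W xW.
by exists C; split => //; [exact/cB/mem_set|exact: oB].
Qed.

Lemma isC1_has_dirderiv (F E : tvsType R) (f : F -> E) U x v :
  isC 1 U f -> U x -> has_dirderiv f x v (dirderiv v f x).
Proof. by move=> [fd _] Ux; apply: dirderivP; exact: (fd x [::] v). Qed.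

Lemma isC1_continuous (F E : tvsType R) (f : F -> E) U x v :
  isC 1 U f -> U x ->
  {for (x, v), continuous (fun z : F * F => dirderiv z.2 f z.1)}.
Proof.
move=> [_ /(_ 1%N x (fun=> v) isT) fc] Ux; have {fc} := fc Ux.
set g := (X in {for _, continuous X}) => gc.
have -> : (fun z : F * F => dirderiv z.2 f z.1) =
    (fun z : F * F => g (z.1, (fun=> z.2) : {ptws 'I_1 -> F})).
  by apply/funext => z; rewrite /g /= /image_mem enum_ordSl enum_ord0.
apply: (@cvg_comp _ _ _ (fun z : F * F => (z.1, (fun=> z.2) : {ptws 'I_1 -> F}))
   g _ (nbhs (x, (fun=> v) : {ptws 'I_1 -> F}))); last exact: gc.
apply: (@cvg_pair _ _ _ _ (nbhs x) (nbhs ((fun=> v) : {ptws 'I_1 -> F})));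
  first exact: cvg_fst.
apply/cvg_sup => i A [B [[C oC <-] Bv] BA].
have : z.2 @[z --> ((x, v) : F * F)] --> v by exact: cvg_snd.
move=> /(_ C (open_nbhs_nbhs (conj oC Bv))).
move=> hC; near=> z; apply: BA; near: z; exact: hC.
Unshelve. all: by end_near.
Qed.

Lemma isC1_hadamard (F E : tvsType R) (f : F -> E) U x v (y : R -> F) :
  open U -> isC 1 U f -> U x -> y @ 0^' --> v ->
  t^-1 *: (f (x + t *: y t) - f x) @[t --> 0^'] --> dirderiv v f x.
Proof.
move=> oU fC1 Ux yv W /tvs_convex_nbhs[C [cC oC Cfx CW]].
have [[A M]/= [xA vM] AMC] :=
  isC1_continuous (v := v) fC1 Ux (open_nbhs_nbhs (conj oC Cfx)).
have [N [cN oN Nx NA]] :=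
  tvs_convex_nbhs (filterI xA (open_nbhs_nbhs (conj oU Ux))).
have xty : x + t *: y t @[t --> 0^'] --> x.
  rewrite -[X in _ --> X]addr0 -[X in _ --> _ + X](scale0r v).
  apply: cvgD_tvs; first exact: cvg_cst.
  by apply: cvgZ_tvs => //; exact: nbhs_dnbhs.
have nN : \forall t \near 0^', N (x + t *: y t).
  by apply: xty; apply: open_nbhs_nbhs.
have nM : \forall t \near 0^', M (y t) by apply: yv.
have n0 : \forall t \near (0 : R)^', t != 0 by exact: nbhs_dnbhs_neq.
rewrite /fmap /=; apply: filterS3 nN nM n0 => t Nt Mt t0; apply: CW.
pose u (s : R) := t^-1 *: f (x + s *: (t *: y t)).
have -> : t^-1 *: (f (x + t *: y t) - f x) = u 1 - u 0.
  by rewrite /u scale1r scale0r addr0 scalerBr.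
apply: convex_mean_value => // s /andP[s0 s1].
set z := x + s *: (t *: y t).
have Nz : N z.
  have -> : z = (1 - s) *: x + s *: (x + t *: y t).
    by rewrite scalerDr addrA -scalerDl subrK scale1r.
  by apply: convex_setP => //; [rewrite subr_ge0|rewrite subrK].
have [Az Uz] := NA _ Nz.
exists (dirderiv (y t) f z); first exact: (AMC (z, y t)).
have th : t * h @[h --> (0 : R)^'] --> 0^'.
  move=> B /nbhs_ballP[e /= e0 eB]; apply/nbhs_ballP.
  exists (e / `|t|) => /=; first by rewrite divr_gt0// normr_gt0.
  move=> h; rewrite /ball /= sub0r normrN => he h0; apply: eB.
    by rewrite /ball /= sub0r normrN normrM mulrC -ltr_pdivlMr// normr_gt0.
  by rewrite mulf_neq0.
have := cvg_comp _ _ th (isC1_has_dirderiv (v := y t) fC1 Uz).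
apply: cvg_trans; apply: near_eq_cvg; apply: nearW => h /=.
have e : x + (s + h) *: (t *: y t) = z + (t * h) *: y t.
  by rewrite /z scalerDl addrA (scalerA h) [h * t]mulrC.
by rewrite /diffquot /u e -/z -scalerBr [RHS]scalerA invfM [h^-1 * _]mulrC.
Qed.

Lemma chain_curve (F E : tvsType R) (f : F -> E) U (u : R^o -> F) (s : R^o) w :
  open U -> isC 1 U f -> U (u s) -> has_dirderiv u s 1 w ->
  has_dirderiv (f \o u) s 1 (dirderiv w f (u s)).
Proof.
move=> oU fC1 Us uw; have := isC1_hadamard oU fC1 Us uw.
apply: cvg_trans; apply: near_eq_cvg.
have n0 : \forall t \near (0 : R)^', t != 0 by exact: nbhs_dnbhs_neq.
apply: filterS n0 => t t0; rewrite /diffquot /= scalerA divff// scale1r.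
by congr (_ *: (f _ - _)); rewrite [u s + _]addrC subrK.
Qed.
End CalculusFacts.

Lemma isC1I (R : realType) (F E : tvsType R) (f : F -> E) (U : set F)
  (df : F -> F -> E) : hausdorff_space E -> open U ->
  (forall x v, U x -> has_dirderiv f x v (df x v)) ->
  (forall x, U x -> {for x, continuous f}) ->
  (forall x v, U x -> {for (x, v), continuous (fun z : F * F => df z.1 z.2)}) ->
  isC 1 U f.
Proof.
move=> hE oU fd fc dfc; split=> [x [|//] v Ux _|p x v p1 Ux].
  by exists (df x v); exact: fd.
case: p p1 v => [|[|//]] _ v.
  have -> : (fun z : F * {ptws 'I_0 -> F} =>
      dirderivs [seq z.2 i | i : 'I_0] f z.1) = f \o fst.
    by apply/funext => z; rewrite /image_mem enum_ord0.
  apply: continuous_comp; first exact: cvg_fst.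
  exact: fc.
have -> : (fun z : F * {ptws 'I_1 -> F} =>
    dirderivs [seq z.2 i | i : 'I_1] f z.1) =
    (fun z => dirderiv (z.2 ord0) f z.1).
  by apply/funext => z; rewrite /image_mem enum_ordSl enum_ord0.
have zv : (z.1, z.2 ord0) @[z --> ((x, v) : F * {ptws 'I_1 -> F})] -->
    ((x, v ord0) : F * F).
  apply: (@cvg_pair _ _ _ _ (nbhs x) (nbhs (v ord0))).
    exact: (@cvg_fst _ _ (nbhs x) (nbhs v) _).
  apply: (@cvg_comp _ _ _ snd (fun w : {ptws 'I_1 -> F} => w ord0) _ (nbhs v)).
    exact: (@cvg_snd _ _ (nbhs x) (nbhs v) _).
  exact: (@proj_continuous 'I_1 (fun=> F) ord0 v).
have := cvg_comp _ _ zv (dfc x (v ord0) Ux).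
rewrite /prop_for /continuous_at /= (cvg_diffquot_unique hE (fd x (v ord0) Ux)).
apply: cvg_trans; apply: near_eq_cvg.
have : \forall z \near ((x, v) : F * {ptws 'I_1 -> F}), U z.1.
  exists (U, setT) => /=; last by case=> a b [].
  by split; [exact: open_nbhs_nbhs|exact: filterT].
apply: filterS => z Uz /=; by rewrite (cvg_diffquot_unique hE (fd _ (z.2 ord0) Uz)).
Qed.

Lemma open_oo (R : realType) (a b : R) : open [set s : R^o | a < s < b].
Proof.
have -> : [set s : R^o | a < s < b] = [set` `]a, b[%R].
  by apply/seteqP; split => s /=; rewrite in_itv.
exact: itv_open.
Qed.

Record chart (R : realType) (G : topologicalType) (E : tvsType R) := Chart {
  cdom : set G;
  ccod : set E;
  cmap :> G -> E;
  cinv : E -> G;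
  cdom_open : open cdom;
  ccod_open : open ccod;
  cmap_cod : forall x, cdom x -> ccod (cmap x);
  cinv_dom : forall y, ccod y -> cdom (cinv y);
  cmapK : forall x, cdom x -> cinv (cmap x) = x;
  cinvK : forall y, ccod y -> cmap (cinv y) = y;
  cmap_continuous : forall x, cdom x -> {for x, continuous cmap};
  cinv_continuous : forall y, ccod y -> {for y, continuous cinv} }.

Section Manifold.
Context {R : realType} {G : topologicalType} {E : tvsType R}.
Implicit Types (c : chart G E) (A : set (chart G E)).

Definition smooth_transition c c' :=
  isCinf (ccod c `&` cinv c @^-1` cdom c') (c' \o cinv c).

Definition compatible c c' := smooth_transition c c' /\ smooth_transition c' c.

Definition atlas A :=
  (forall x, exists2 c, A c & cdom c x) /\
  (forall c c', A c -> A c' -> compatible c c').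

(* The charts of the smooth structure generated by the atlas A                *)
Definition maximal_atlas A := [set c | forall c', A c' -> compatible c c'].

(* f : F -> G is C^k on the open set U, for the manifold G with atlas A       *)
Definition isCM A (F : tvsType R) (k : nat) (U : set F) (f : F -> G) :=
  (forall x, U x -> {for x, continuous f}) /\
  (forall c, A c -> isC k (U `&` f @^-1` cdom c) (c \o f)).

End Manifold.

#[short(type="topGroupType")]
HB.structure Definition TopGroup := {G of Group G & Topological G}.

Record lieGroup (R : realType) (E : tvsType R) := LieGroup {
  lg_sort :> topGroupType;
  lg_atlas : set (chart lg_sort E);
  model_hausdorff : hausdorff_space E;
  lg_hausdorff : hausdorff_space lg_sort;
  lg_atlasP : atlas lg_atlas;
  lg_mul_smooth : forall c c', lg_atlas c -> lg_atlas c' -> forall k,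
    isCM lg_atlas k (ccod c `*` ccod c')
      (fun z : E * E => (cinv c z.1 * cinv c' z.2)%g);
  lg_inv_smooth : forall c, lg_atlas c -> forall k,
    isCM lg_atlas k (ccod c) (fun y : E => (cinv c y)^-1%g) }.

Arguments lg_atlas {R E} l.

Section TangentSpace.
Context {R : realType} {E : tvsType R} {G : lieGroup E}.
Implicit Types (x : G) (gamma eta : R^o -> G).

(* Tangent vectors at x are classes of C^1 curves through x at time 0, two    *)
(* curves being equivalent if they have the same velocity in all charts at x. *)
Definition curve_at x gamma := gamma 0 = x /\
  exists2 e : R, 0 < e & isCM (lg_atlas G) 1 [set s : R^o | - e < s < e] gamma.

Definition chart_velocity (c : chart G E) gamma (t : R^o) : E :=
  dirderiv (1 : R^o) (c \o gamma) t.

Definition same_velocity x gamma eta := forall c, lg_atlas G c -> cdom c x ->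
  chart_velocity c gamma 0 = chart_velocity c eta 0.

Definition tangent_class x gamma :=
  [set eta | curve_at x eta /\ same_velocity x gamma eta].

Record tangent x := Tangent {
  tset : set (R^o -> G);
  tsetP : exists2 gamma, curve_at x gamma & tset = tangent_class x gamma }.

HB.instance Definition _ x := gen_eqMixin (tangent x).
HB.instance Definition _ x := gen_choiceMixin (tangent x).

Lemma transition_velocity x gamma (c c' : chart G E) w :
  gamma 0 = x -> {for (0 : R^o), continuous gamma} ->
  cdom c x -> cdom c' x -> smooth_transition c c' ->
  has_dirderiv (c \o gamma) (0 : R^o) 1 w ->
  has_dirderiv (c' \o gamma) (0 : R^o) 1 (dirderiv w (c' \o cinv c) (c x)).
Proof.
move=> g0 gc cx c'x cc' cw.
have oU : open (ccod c `&` cinv c @^-1` cdom c').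
  rewrite openE => y [cy c'y]; apply: filterI.
    by apply: open_nbhs_nbhs; split => //; exact: ccod_open.
  apply: cinv_continuous => //.
  by apply: open_nbhs_nbhs; split => //; exact: cdom_open.
have Ux : (ccod c `&` cinv c @^-1` cdom c') ((c \o gamma) 0).
  by rewrite /= g0; split; [exact: cmap_cod|rewrite /= cmapK].
have := chain_curve oU (cc' 1%N) Ux cw.
rewrite /= g0; apply: near_dirderiv.
have : \forall s \near (0 : R^o), cdom c (gamma s).
  by apply: gc; rewrite g0; apply: open_nbhs_nbhs; split => //; exact: cdom_open.
by apply: filterS => s cs /=; rewrite cmapK.
Qed.

Lemma curve_continuous x gamma : curve_at x gamma -> {for (0 : R^o), continuous gamma}.
Proof.
by move=> [_ [e e0 [gc _]]]; apply: gc; rewrite /= oppr_lt0 e0.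
Qed.

Lemma curve_has_velocity x gamma c : curve_at x gamma -> lg_atlas G c ->
  cdom c x -> has_dirderiv (c \o gamma) (0 : R^o) 1 (chart_velocity c gamma 0).
Proof.
move=> [g0 [e e0 [_ gc]]] Ac cx; apply: (isC1_has_dirderiv (gc c Ac)).
by split; rewrite /= ?g0// oppr_lt0 e0.
Qed.

Lemma maximal_has_velocity x gamma (Xi : chart G E) :
  maximal_atlas (lg_atlas G) Xi -> cdom Xi x -> curve_at x gamma ->
  has_dirderiv (Xi \o gamma) (0 : R^o) 1 (chart_velocity Xi gamma 0).
Proof.
move=> mXi Xix gx; have [c Ac cx] := (lg_atlasP G).1 x.
apply: dirderivP; eexists.
exact: (transition_velocity gx.1 (curve_continuous gx) cx Xix (mXi c Ac).2
          (curve_has_velocity gx Ac cx)).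
Qed.

Lemma same_velocityP x gamma eta (Xi : chart G E) :
  maximal_atlas (lg_atlas G) Xi -> cdom Xi x -> curve_at x gamma -> curve_at x eta ->
  same_velocity x gamma eta <->
  chart_velocity Xi gamma 0 = chart_velocity Xi eta 0.
Proof.
move=> mXi Xix gx ex; split=> [ge|ge c Ac cx].
  have [c Ac cx] := (lg_atlasP G).1 x.
  have h z : curve_at x z -> chart_velocity Xi z 0 =
      dirderiv (chart_velocity c z 0) (Xi \o cinv c) (c x).
    move=> zx; apply: cvg_diffquot_unique; first exact: (model_hausdorff G).
    exact: (transition_velocity zx.1 (curve_continuous zx) cx Xix (mXi c Ac).2
             (curve_has_velocity zx Ac cx)).
  by rewrite !h// (ge c).
have h z : curve_at x z -> chart_velocity c z 0 =
    dirderiv (chart_velocity Xi z 0) (c \o cinv Xi) (Xi x).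
  move=> zx; apply: cvg_diffquot_unique; first exact: (model_hausdorff G).
  exact: (transition_velocity zx.1 (curve_continuous zx) Xix cx (mXi c Ac).1
           (maximal_has_velocity mXi Xix zx)).
by rewrite !h// ge.
Qed.

Lemma curve_at_line x (Xi : chart G E) (w : E) :
  maximal_atlas (lg_atlas G) Xi -> cdom Xi x ->
  curve_at x (fun s => cinv Xi (Xi x + s *: w)).
Proof.
move=> mXi Xix; split; first by rewrite scale0r addr0 cmapK.
pose L (s : R^o) := Xi x + s *: w.
have Lc : continuous L.
  move=> s; apply: cvgD_tvs; first exact: cvg_cst.
  by apply: cvgZ_tvs; [exact: cvg_id|exact: cvg_cst].
have : \forall s \near (0 : R^o), ccod Xi (L s).
  apply: Lc; apply: open_nbhs_nbhs; split; first exact: ccod_open.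
  by rewrite /L scale0r addr0; exact: cmap_cod.
move=> /nbhs_ballP[e /= e0 eL]; exists e => //.
have Le s : - e < s < e -> ccod Xi (L s).
  move=> /andP[s1 s2]; apply: eL.
  by rewrite /ball /= sub0r normrN ltr_norml s1.
split=> [s /Le Ls|c Ac].
  by apply: continuous_comp; [exact: Lc|exact: cinv_continuous].
have cXi := (mXi c Ac).1 1%N.
set U := (ccod Xi `&` cinv Xi @^-1` cdom c) in cXi.
have oU : open U.
  rewrite openE => y [cy c'y]; apply: filterI.
    by apply: open_nbhs_nbhs; split => //; exact: ccod_open.
  apply: cinv_continuous => //.
  by apply: open_nbhs_nbhs; split => //; exact: cdom_open.
have -> : [set s : R^o | - e < s < e] `&` (fun s : R^o => cinv Xi (Xi x + s *: w)) @^-1` cdom c =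
    [set s : R^o | - e < s < e] `&` L @^-1` U.
  apply/seteqP; split => s [se] /=; first by split => //; split => //; exact: Le.
  by move=> [_]; split.
apply: (@isC1I R R^o E _ _ (fun (s v : R^o) => dirderiv (v *: w) (c \o cinv Xi) (L s))).
- exact: (model_hausdorff G).
- by apply: openI; [exact: open_oo|apply: open_comp => // s _; exact: Lc].
- move=> s v [_ /= Us].
  have := isC1_has_dirderiv (v := v *: w) cXi Us.
  apply: cvg_trans; apply: near_eq_cvg; apply: nearW => t.
  by rewrite /diffquot /L /= scalerDl addrA scalerA.
- move=> s [se [Us Us']]; apply: continuous_comp; last first.
    by apply: cmap_continuous; exact: Us'.
  by apply: continuous_comp; [exact: Lc|exact: cinv_continuous].
- move=> s v [se Us].
  have h : (L z.1, z.2 *: w) @[z --> ((s, v) : R^o * R^o)] --> ((L s, v *: w) : E * E).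
    apply: (@cvg_pair _ _ _ _ (nbhs (L s)) (nbhs (v *: w))).
      exact: (cvg_comp _ _ (@cvg_fst _ _ (nbhs s) (nbhs v) _) (Lc s)).
    by apply: cvgZ_tvs; [exact: (@cvg_snd _ _ (nbhs s) (nbhs v) _)|exact: cvg_cst].
  exact: (cvg_comp _ _ h (isC1_continuous (v := v *: w) cXi Us)).
Qed.

Lemma curve_at_cst x : curve_at x (fun=> x).
Proof.
have [c Ac cx] := (lg_atlasP G).1 x.
have mc : maximal_atlas (lg_atlas G) c.
  by move=> c' Ac'; exact: (lg_atlasP G).2.
have := curve_at_line 0 mc cx; congr curve_at.
by apply/funext => s; rewrite scaler0 addr0 cmapK.
Qed.

(* The class of gamma; the junk value is the zero vector.                     *)
Definition tvec x gamma : tangent x :=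
  match pselect (curve_at x gamma) with
  | left h => Tangent (ex_intro2 _ _ gamma h erefl)
  | right _ => Tangent (ex_intro2 _ _ (fun=> x) (curve_at_cst x) erefl)
  end.

Definition trep x (X : tangent x) : R^o -> G := xget (fun=> x) (tset X).

(* d_x c for a chart c at x                                                   *)
Definition dchart (c : chart G E) x (X : tangent x) : E :=
  chart_velocity c (trep X) 0.

(* d_x f : T_x G -> T_y G, for f of class C^1 near x with f x = y             *)
Definition tangent_map x y (f : G -> G) (X : tangent x) : tangent y :=
  tvec y (f \o trep X).

Definition velocity (mu : R^o -> G) (t : R^o) : tangent (mu t) :=
  tvec (mu t) (fun s => mu (t + s)).

(* delta^r(mu)(t): the image of the velocity mu'(t) under the differential at *)
(* mu(t) of the right translation by mu(t)^-1                                 *)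
Definition rlogder (mu : R^o -> G) (t : R^o) : tangent (1%g : G) :=
  tangent_map 1%g (fun g => (g * (mu t)^-1)%g) (velocity mu t).

Lemma tangent_class_refl x gamma : curve_at x gamma -> tangent_class x gamma gamma.
Proof. by move=> gx; split. Qed.

Lemma trepP x (X : tangent x) : tset X (trep X).
Proof.
have [gamma gx Xg] := tsetP X.
by apply: (@xgetPex _ _ (tset X)); exists gamma; rewrite Xg; exact: tangent_class_refl.
Qed.

Lemma trep_curve x (X : tangent x) : curve_at x (trep X).
Proof. by have := trepP X; have [gamma gx ->] := tsetP X; case. Qed.

Lemma tsetE x (X : tangent x) : tset X = tangent_class x (trep X).
Proof.
have := trepP X; have [gamma gx ->] := tsetP X => -[tx gt].
apply/seteqP; split => eta [ex ge]; split => // c Ac cx; last by rewrite gt// ge.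
by rewrite -gt// ge.
Qed.

Lemma tset_inj x (X Y : tangent x) : tset X = tset Y -> X = Y.
Proof. by case: X Y => [A hA] [B hB] /= AB; subst B; congr Tangent; exact: Prop_irrelevance. Qed.

Lemma trep_tvec x gamma : curve_at x gamma -> same_velocity x gamma (trep (tvec x gamma)).
Proof.
move=> gx; have := trepP (tvec x gamma); rewrite /tvec.
by case: pselect => //= h [].
Qed.

Lemma dchart_inj x (Xi : chart G E) : maximal_atlas (lg_atlas G) Xi ->
  cdom Xi x -> injective (@dchart Xi x).
Proof.
move=> mXi Xix X Y /(same_velocityP mXi Xix (trep_curve X) (trep_curve Y)) XY.
apply: tset_inj; rewrite !tsetE; apply/seteqP.
by split => eta [ex ge]; split => // c Ac cx; rewrite -ge// XY.
Qed.

Lemma dchart_tvec x (Xi : chart G E) gamma : maximal_atlas (lg_atlas G) Xi ->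
  cdom Xi x -> curve_at x gamma ->
  dchart Xi (tvec x gamma) = chart_velocity Xi gamma 0.
Proof.
move=> mXi Xix gx; apply/esym.
apply/(same_velocityP mXi Xix gx (trep_curve _)); exact: trep_tvec.
Qed.

Lemma dchart_line x (Xi : chart G E) w : maximal_atlas (lg_atlas G) Xi ->
  cdom Xi x -> dchart Xi (tvec x (fun s => cinv Xi (Xi x + s *: w))) = w.
Proof.
move=> mXi Xix; rewrite dchart_tvec//; last exact: curve_at_line.
have L0 : Xi x + s *: w @[s --> (0 : R)] --> Xi x by exact: cvg_line.
apply: cvg_diffquot_unique; first exact: (model_hausdorff G).
apply: (@near_dirderiv R R^o E (fun s : R^o => Xi x + s *: w)).
  have := L0 _ (open_nbhs_nbhs (conj (@ccod_open _ _ _ Xi) (cmap_cod Xix))).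
  move=> L1; near=> s => /=; rewrite cinvK//; near: s; exact: L1.
have h : cst w t @[t --> (0 : R)^'] --> w by exact: cvg_cst.
apply: cvg_trans h; apply: near_eq_cvg.
have n0 : \forall t \near (0 : R)^', t != 0 by exact: nbhs_dnbhs_neq.
apply: filterS n0 => t t0.
rewrite /diffquot scale0r addr0 add0r [Xi x + _]addrC addrK scalerA.
by rewrite [t *: 1]mulr1 mulVf// scale1r.
Unshelve. all: by end_near. Qed.

End TangentSpace.

Record unitChart (R : realType) (E : tvsType R) (G : lieGroup E) := UnitChart {
  uchart :> chart G E;
  uchart_max : maximal_atlas (lg_atlas G) uchart;
  uchart_dom1 : cdom uchart 1%g;
  uchart1 : uchart 1%g = 0;
  uchart_convex : convex_set (ccod uchart) }.

(* T_e G with the structure of locally convex space for which the bijection   *)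
(* d_e Xi : T_e G -> E is a linear homeomorphism; Xi only serves to transport *)
(* this structure.                                                            *)
Definition lieAlg (R : realType) (E : tvsType R) (G : lieGroup E)
  (Xi : unitChart G) : Type := tangent (1%g : G).

Section LieAlgebra.
Context {R : realType} {E : tvsType R} {G : lieGroup E} (Xi : unitChart G).
Local Notation g := (lieAlg Xi).

HB.instance Definition _ := Choice.on g.

Definition dXi : g -> E := @dchart R E G Xi 1%g.

Definition dXi_inv (w : E) : g :=
  tvec 1%g (fun s : R^o => cinv Xi (Xi 1%g + s *: w)).

Lemma dXi_invK : cancel dXi_inv dXi.
Proof. by move=> w; apply: dchart_line; [exact: uchart_max|exact: uchart_dom1]. Qed.

Lemma dXiK : cancel dXi dXi_inv.
Proof.
move=> X; apply: (@dchart_inj R E G 1%g Xi (uchart_max Xi) (uchart_dom1 Xi)).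
exact: dXi_invK.
Qed.

Definition lie_zero : g := dXi_inv 0.
Definition lie_opp (X : g) : g := dXi_inv (- dXi X).
Definition lie_add (X Y : g) : g := dXi_inv (dXi X + dXi Y).
Definition lie_scale (a : R) (X : g) : g := dXi_inv (a *: dXi X).

Lemma lie_addA : associative lie_add.
Proof. by move=> X Y Z; rewrite /lie_add !dXi_invK addrA. Qed.
Lemma lie_addC : commutative lie_add.
Proof. by move=> X Y; rewrite /lie_add addrC. Qed.
Lemma lie_add0 : left_id lie_zero lie_add.
Proof. by move=> X; rewrite /lie_add dXi_invK add0r dXiK. Qed.
Lemma lie_addN : left_inverse lie_zero lie_opp lie_add.
Proof. by move=> X; rewrite /lie_add dXi_invK addNr. Qed.

HB.instance Definition _ :=
  GRing.isZmodule.Build g lie_addA lie_addC lie_add0 lie_addN.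

Lemma lie_scaleA a b X : lie_scale a (lie_scale b X) = lie_scale (a * b) X.
Proof. by rewrite /lie_scale dXi_invK scalerA. Qed.
Lemma lie_scale1 : left_id 1 lie_scale.
Proof. by move=> X; rewrite /lie_scale scale1r dXiK. Qed.
Lemma lie_scaleDr : right_distributive lie_scale +%R.
Proof.
move=> a X Y; rewrite -[LHS]/(dXi_inv _) -[X + Y]/(lie_add X Y).
by rewrite -[RHS]/(lie_add _ _) /lie_scale /lie_add !dXi_invK scalerDr.
Qed.
Lemma lie_scaleDl X : {morph lie_scale^~ X : a b / a + b}.
Proof.
move=> a b; rewrite -[RHS]/(lie_add _ _) /lie_scale /lie_add.
by rewrite !dXi_invK scalerDl.
Qed.

HB.instance Definition _ := GRing.Zmodule_isLmodule.Build R g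
  lie_scaleA lie_scale1 lie_scaleDr lie_scaleDl.

Lemma dXiD X Y : dXi (X + Y) = dXi X + dXi Y. Proof. exact: dXi_invK. Qed.
Lemma dXiZ a X : dXi (a *: X) = a *: dXi X. Proof. exact: dXi_invK. Qed.

HB.instance Definition _ := Uniform.copy g (initial_topology dXi).

Lemma dXi_continuous : continuous dXi.
Proof. exact: initial_continuous. Qed.

Lemma cvg_dXi (Fl : set_system g) {FF : Filter Fl} (X : g) :
  dXi @ Fl --> dXi X -> Fl --> X.
Proof.
move=> h A [B [[C oC <-] CX] CA].
apply: (filterS CA); exact: (h C (open_nbhs_nbhs (conj oC CX))).
Qed.

Lemma lie_add_continuous : continuous (fun z : g * g => z.1 + z.2).
Proof.
move=> [X Y].
have h : dXi z.1 + dXi z.2 @[z --> ((X, Y) : g * g)] --> dXi X + dXi Y.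
  apply: cvgD_tvs.
    exact: (cvg_comp _ _ (@cvg_fst _ _ (nbhs X) (nbhs Y) _) (dXi_continuous (x := X))).
  exact: (cvg_comp _ _ (@cvg_snd _ _ (nbhs X) (nbhs Y) _) (dXi_continuous (x := Y))).
apply: (@cvg_dXi _ _ (X + Y)); rewrite dXiD.
suff : (fun z : g * g => dXi (z.1 + z.2)) @ (X, Y) --> dXi X + dXi Y by [].
by under eq_fun do rewrite dXiD.
Qed.

Lemma lie_scale_continuous : continuous (fun z : R^o * g => z.1 *: z.2).
Proof.
move=> [a X].
have h : z.1 *: dXi z.2 @[z --> ((a, X) : R^o * g)] --> a *: dXi X.
  apply: cvgZ_tvs; first exact: (@cvg_fst _ _ (nbhs (a : R^o)) (nbhs X) _).
  exact: (cvg_comp _ _ (@cvg_snd _ _ (nbhs (a : R^o)) (nbhs X) _)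
                       (dXi_continuous (x := X))).
apply: (@cvg_dXi _ _ (a *: X)); rewrite dXiZ.
suff : (fun z : R^o * g => dXi (z.1 *: z.2)) @ ((a : R^o), X) --> a *: dXi X by [].
by under eq_fun do rewrite dXiZ.
Qed.

Lemma lie_locally_convex : exists2 B : set_system g,
  (forall b, b \in B -> convex_set b) & basis B.
Proof.
have [B cB [oB bB]] := @locally_convex R E.
exists [set dXi @^-1` b | b in B].
  move=> _ /set_mem[b Bb <-] X Y l /set_mem bX /set_mem bY; apply/mem_set.
  rewrite /conv /= dXiD !dXiZ.
  exact/set_mem/(cB b (mem_set Bb) (dXi X) (dXi Y) l (mem_set bX) (mem_set bY)).
split=> [_ [b Bb <-]|X A [_ [[C oC <-] CX] CA]].
  by exists b => //; exact: oB.
have [b [Bb bX] bC] := bB (dXi X) C (open_nbhs_nbhs (conj oC CX)).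
exists (dXi @^-1` b); first by split => //; exists b.
by move=> Y bY; apply: CA; exact: bC.
Qed.

HB.instance Definition _ := PreTopologicalNmodule_isTopologicalNmodule.Build
  g lie_add_continuous.
HB.instance Definition _ := TopologicalNmodule_isTopologicalLmodule.Build
  R g lie_scale_continuous.
HB.instance Definition _ := Uniform_isTvs.Build R g lie_locally_convex.
End LieAlgebra.

(* The elements of N + {lip, oo}; order_le s k is the relation "s precedes k" *)
(* on the orders s of the seminorms that define the C^k-topology.             *)
Inductive regularity := Cfin of nat | Clip | Cinfty.

Definition order_le (s : nat) (k : regularity) : bool :=
  match k with Cfin n => (s <= n)%N | Clip => s == 0%N | Cinfty => true end.

Definition continuous_seminorm (R : realType) (E : tvsType R) (p : E -> R) :=
  [/\ forall x y, p (x + y) <= p x + p y,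
      forall (a : R) x, p (a *: x) = `|a| * p x & continuous p].

Section Evolution.
Context {R : realType} {E : tvsType R} {G : lieGroup E} (Xi : unitChart G).
Implicit Types (phi psi : R^o -> lieAlg Xi) (mu : R^o -> G).

(* Curves on [r, r'] are total functions of which only the values on [r, r']  *)
(* are relevant.                                                              *)
Definition curveC (k : regularity) (r r' : R) phi : Prop :=
  match k with
  | Cfin n => exists a b psi, [/\ a < r, r' < b,
      isC n [set s : R^o | a < s < b] psi &
      forall t, r <= t <= r' -> phi t = psi t]
  | Cinfty => exists a b psi, [/\ a < r, r' < b,
      isCinf [set s : R^o | a < s < b] psi &
      forall t, r <= t <= r' -> phi t = psi t]
  | Clip => forall p : E -> R, continuous_seminorm p ->
      exists2 L : R, 0 <= L & forall t t', r <= t <= r' -> r <= t' <= r' ->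
        p (dXi (phi t - phi t')) <= L * `|t - t'|
  end.

(* mu is given with its extension to an open interval; its values and those   *)
(* of rlogder mu on [r, r'] only depend on its restriction to [r, r'].        *)
Definition curveG (r r' : R) mu := exists a b, [/\ a < r, r' < b &
  isCM (lg_atlas G) 1 [set s : R^o | a < s < b] mu].

Definition has_rlogder (r r' : R) phi mu :=
  curveG r r' mu /\ forall t, r <= t <= r' -> phi t = rlogder mu t.

Definition evol_dom (k : regularity) (r r' : R) : set (R^o -> lieAlg Xi) :=
  [set phi | curveC k r r' phi /\ exists mu, has_rlogder r r' phi mu].

(* mu r' * (mu r)^-1 does not depend on the choice of mu with right logarithmic *)
(* derivative phi on [r, r'].                                                 *)
Definition evol (r r' : R) phi : G :=
  xget 1%g [set g | exists2 mu, has_rlogder r r' phi mu &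
                      g = (mu r' * (mu r)^-1)%g].

(* Derivative relative to [r, r'], hence one-sided at the end points.         *)
Definition derive_on (r r' : R) phi : R^o -> lieAlg Xi := fun t =>
  xget 0 [set X | (s - t)^-1 *: (phi s - phi t)
                    @[s --> within [set s | r <= s <= r'] t^'] --> X].

Definition Ck_seminorm (r r' : R) (p : E -> R) (s : nat) phi : R :=
  sup [set y | exists m t, [/\ (m <= s)%N, r <= t <= r' &
                 y = p (dXi (iter m (derive_on r r') phi t))]].

(* Neighbourhoods of phi for the topology generated by the Ck_seminorm's of   *)
(* orders admissible for k                                                    *)
Definition Ck_nbhs (k : regularity) (r r' : R) phi : set_system (R^o -> lieAlg Xi) :=
  [set V | exists n (p : 'I_n -> E -> R) (s : 'I_n -> nat) (e : R),
    [/\ 0 < e, forall i, continuous_seminorm (p i) /\ order_le (s i) k &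
        forall psi, (forall i,
          Ck_seminorm r r' (p i) (s i) (fun t => psi t - phi t) < e) -> V psi]].

Definition k_continuous (k : regularity) := forall r r' : R, r < r' ->
  forall phi, evol_dom k r r' phi ->
    evol r r' @ within (evol_dom k r r') (Ck_nbhs k r r' phi)
      --> evol r r' phi.

End Evolution.

(* A tvsType carries a uniform structure that is only required to induce its  *)
(* topology, so Cauchy filters are expressed with the translation-invariant   *)
(* uniformity rather than with [cauchy].                                      *)
Record completion (R : realType) (V : tvsType R) := Completion {
  cpl_sort :> tvsType R;
  cpl_inj : {linear V -> cpl_sort};
  cpl_hausdorff : hausdorff_space cpl_sort;
  cpl_embedding : forall x A,
    nbhs x A <-> exists2 B, nbhs (cpl_inj x) B & cpl_inj @^-1` B `<=` A;
  cpl_dense : dense (range cpl_inj);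
  cpl_complete : forall F : set_system cpl_sort, ProperFilter F ->
    z.1 - z.2 @[z --> (F, F)] --> (0 : cpl_sort) ->
    exists x : cpl_sort, F --> x }.

Section RiemannIntegral.
Context {R : realType} {V : tvsType R}.

Definition tagged_partition (a b d : R) (n : nat) (x xi : nat -> R) :=
  [/\ x 0%N = a, x n = b & forall i, (i < n)%N ->
      [/\ x i <= xi i, xi i <= x i.+1 & x i.+1 - x i < d]].

Definition is_riemann_integral (f : R -> V) (a b : R) (I : V) :=
  forall W, nbhs I W -> exists2 d : R, 0 < d &
    forall n x xi, tagged_partition a b d n x xi ->
      W (\sum_(i < n) (x i.+1 - x i) *: f (xi i)).

End RiemannIntegral.

(* d/dh|_{h=0} g(h) = Z, for a map g defined near 0 with g(0) = e             *)
Definition derivative_at_unit (R : realType) (E : tvsType R) (G : lieGroup E)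
    (Xi : unitChart G) (gbar : completion (lieAlg Xi)) (Ebar : completion E)
    (dXibar : gbar -> Ebar) (g : R -> G) (Z : gbar) :=
  [/\ g 0 = 1%g, \forall h \near (0 : R), cdom Xi (g h) &
      h^-1 *: cpl_inj Ebar (Xi (g h)) @[h --> (0 : R)^'] --> dXibar Z].

(* Main.v *)
Require Import Defs.
From HB Require Import structures.
From mathcomp Require Import all_boot all_order all_algebra.
From mathcomp Require Import all_classical all_reals.
From mathcomp Require Import topology normedtype tvs convex.
From mathcomp Require Import ring lra.

Set Implicit Arguments.
Unset Strict Implicit.
Unset Printing Implicit Defensive.
Import Order.TTheory GRing.Theory Num.Theory.
Import numFieldNormedType.Exports.
Local Open Scope classical_set_scope.
Local Open Scope ring_scope.

(** Write [mu_h] for a curve with logarithmic derivative [h *: phi] on [[r, r']] and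
[gamma_h t = Xi (mu_h t * (mu_h r)^-1)]. In the unit chart the equation for [mu_h]
reads [gamma_h' = h *: chart_field Xi gamma_h (dXi phi)] ([chart_equation]), where
[chart_field Xi y v] is the derivative at the unit, in direction [v], of the
multiplication read in the chart, with second factor [y]. It is continuous in
[(y, v)] and [chart_field Xi 0 v = v]. So as soon as [gamma_h] tends to [0] uniformly
on [[r, r']] when [h] tends to [0], the derivative of [h^-1 *: gamma_h] is uniformly
close to [dXi phi] ([evol_chart_curves]). The mean value theorem for convex open
sets then shows that the quotients [h^-1 *: gamma_h r'] form a Cauchy filter
([quotients_cauchy]) and that they are close to all fine Riemann sums of [phi]
([riemann_quotient_near]). Their limit in the completion is therefore at once the
integral of [phi] and the derivative of the evolution at zero.

Continuity of the evolution at zero only controls the endpoint [gamma_h r']. It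
controls all [gamma_h t] at once because [mu_h t * (mu_h r)^-1] is itself an evolution
over [[r, r']]: that of [h *: phi] contracted affinely onto [[r, t]] and multiplied by
the contraction factor [c <= 1]. Every derivative picks up a further factor [c], so
the seminorms of these curves are bounded by [`|h|] times a constant that does not
depend on [t] ([derivative_bound], [evol_zero_uniform]).

This identification needs that the evolution depends on the logarithmic derivative
only ([rlogder_eq_evol]). Solutions of differential equations in locally convex spaces need
not be unique, but here the group structure helps: if [mu] and [nu]
have the same logarithmic derivative, then [nu^-1 * mu] has zero velocity in every
chart ([quotient_flat]), hence is constant.

Continuity of [phi] itself, which the Lipschitz condition expresses through
seminorms, is read off from a curve [mu] with logarithmic derivative
[(delta / 2) *: phi] ([evol_dom_continuous_extension]). *)

(** * Local calculus of continuously differentiable maps *)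

Section LocalC1.
Context {R : realType}.

(** A pointwise form of [isC 1], stable under restriction, so that maps defined
    by charts can be composed without keeping track of their domains. *)
Definition C1at (F E : tvsType R) (f : F -> E) (x : F) : Prop :=
  exists U, [/\ open U, U x & isC 1 U f].

Section Generalities.
Context {F E : tvsType R}.
Implicit Types (f g : F -> E) (U : set F).

Lemma isC_continuous k f U x : isC k U f -> U x -> {for x, continuous f}.
Proof.
move=> [_ /(_ 0%N x (fun=> 0) isT)] h Ux.
have {h} := h Ux.
have -> : (fun z : F * {ptws 'I_0 -> F} =>
    dirderivs [seq z.2 i | i : 'I_0] f z.1) = f \o fst.
  by apply/funext => z; rewrite /image_mem enum_ord0.
move=> h.
apply: (@cvg_comp _ _ _ (fun z : F => (z, (fun=> 0) : {ptws 'I_0 -> F}))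
  (f \o fst) _ (nbhs (x, (fun=> 0) : {ptws 'I_0 -> F}))); last exact: h.
apply: (@cvg_pair _ _ _ _ (nbhs x) (nbhs ((fun=> 0) : {ptws 'I_0 -> F})));
  [exact: cvg_id|exact: cvg_cst].
Qed.

Lemma isC_C1at f U x : open U -> U x -> isC 1 U f -> C1at f x.
Proof. by move=> oU Ux fU; exists U. Qed.

Lemma C1at_near f x : C1at f x -> \forall y \near x, C1at f y.
Proof.
move=> [U [oU Ux fU]]; apply: (filterS _ (open_nbhs_nbhs (conj oU Ux))) => y Uy.
exact: isC_C1at fU.
Qed.

Lemma C1at_continuous f x : C1at f x -> {for x, continuous f}.
Proof. by move=> [U [_ Ux fU]]; exact: isC_continuous fU Ux. Qed.

Lemma C1at_dirderiv f x v : C1at f x -> has_dirderiv f x v (dirderiv v f x).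
Proof. by move=> [U [_ Ux fU]]; exact: isC1_has_dirderiv fU Ux. Qed.

Lemma C1at_dirderiv_continuous f x v : C1at f x ->
  {for (x, v), continuous (fun z : F * F => dirderiv z.2 f z.1)}.
Proof. by move=> [U [_ Ux fU]]; exact: isC1_continuous fU Ux. Qed.

Lemma C1at_chain f (u : R^o -> F) s w : C1at f (u s) ->
  has_dirderiv u s 1 w -> has_dirderiv (f \o u) s 1 (dirderiv w f (u s)).
Proof. by move=> [U [oU Us fU]]; exact: chain_curve oU fU Us. Qed.

Hypothesis hE : hausdorff_space E.

Lemma C1at_isC f U : open U -> (forall x, U x -> C1at f x) -> isC 1 U f.
Proof.
move=> oU fU; apply: (isC1I (df := fun x v => dirderiv v f x)) => //.
- by move=> x v /fU; exact: C1at_dirderiv.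
- by move=> x /fU; exact: C1at_continuous.
- by move=> x v /fU; exact: C1at_dirderiv_continuous.
Qed.

Lemma C1at_eq_near f g x : (\forall y \near x, f y = g y) -> C1at f x -> C1at g x.
Proof.
move=> /nbhs_interior Vx [U [oU Ux fU]].
set V := (X in X°) in Vx; have {}Vx := nbhs_singleton Vx.
have UVfg y : (U `&` V°) y -> \forall z \near y, f z = g z by case.
have oUV : open (U `&` V°) by apply: openI => //; exact: open_interior.
exists (U `&` V°); split => //.
apply: (isC1I (df := fun x v => dirderiv v f x)) => //.
- by move=> y v UVy; apply: (near_dirderiv (UVfg _ UVy)); exact: isC1_has_dirderiv fU UVy.1.
- move=> y UVy; rewrite /prop_for /continuous_at -(nbhs_singleton (UVfg _ UVy)).
  apply: cvg_trans (isC_continuous fU UVy.1).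
  exact: near_eq_cvg (UVfg _ UVy).
- by move=> y v UVy; exact: isC1_continuous fU UVy.1.
Qed.

Lemma C1at_affine f (L : F -> E) x : (forall y v t, f (y + t *: v) = f y + t *: L v) ->
  continuous f -> continuous L -> C1at f x.
Proof.
move=> fL fc Lc; exists setT; split => //; first exact: openT.
apply: (isC1I (df := fun _ => L)) => //; first exact: openT.
- move=> y v _.
  have h : cst (L v) t @[t --> (0 : R)^'] --> L v by exact: cvg_cst.
  apply: cvg_trans h; apply: near_eq_cvg.
  apply: filterS (nbhs_dnbhs_neq (0 : R)) => t t0.
  by rewrite /diffquot fL addrAC subrr add0r scalerA mulVf// scale1r.
- by move=> y _; exact: fc.
- move=> y v _; apply: (@cvg_comp _ _ _ snd L _ (nbhs v)); last exact: Lc.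
  exact: (@cvg_snd _ _ (nbhs y) (nbhs v) _).
Qed.

End Generalities.

Lemma hausdorff_prod (E1 E2 : topologicalType) : hausdorff_space E1 ->
  hausdorff_space E2 -> hausdorff_space (E1 * E2)%type.
Proof.
move=> h1 h2 [a1 a2] [b1 b2] ab; congr pair.
  apply: h1 => A B aA bB.
  have [] := ab (A `*` setT) (B `*` setT).
  - by exists (A, setT) => //=; split => //; exact: filterT.
  - by exists (B, setT) => //=; split => //; exact: filterT.
  by move=> [z1 z2] [[? _] [? _]]; exists z1.
apply: h2 => A B aA bB.
have [] := ab (setT `*` A) (setT `*` B).
- by exists (setT, A) => //=; split => //; exact: filterT.
- by exists (setT, B) => //=; split => //; exact: filterT.
by move=> [z1 z2] [[_ ?] [_ ?]]; exists z2.
Qed.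

(** Chain rule. The difference quotient of the composite is that of [g] along a
    converging direction, which is the situation of [isC1_hadamard]. *)
Lemma C1at_comp (F E E' : tvsType R) (f : F -> E) (g : E -> E') x :
  hausdorff_space E' -> C1at f x -> C1at g (f x) -> C1at (g \o f) x.
Proof.
move=> hE' [U [oU Ux fU]] [V [oV Vx gV]].
have oW : open (U `&` f @^-1` V).
  rewrite openE => y [Uy Vy]; apply: filterI; first exact: open_nbhs_nbhs.
  by apply: (isC_continuous fU Uy); exact: open_nbhs_nbhs.
exists (U `&` f @^-1` V); split => //.
apply: (isC1I (df := fun x v => dirderiv (dirderiv v f x) g (f x))) => //.
- move=> y v [Uy Vy].
  (* The quotient of f plays the role of the converging direction. *)
  have := isC1_hadamard oV gV Vy (isC1_has_dirderiv (v := v) fU Uy).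
  apply: cvg_trans; apply: near_eq_cvg.
  apply: filterS (nbhs_dnbhs_neq (0 : R)) => t t0.
  rewrite /diffquot /= scalerA divff// scale1r.
  by rewrite [f y + _]addrC subrK.
- move=> y [Uy Vy]; apply: continuous_comp; first exact: isC_continuous fU Uy.
  exact: isC_continuous gV Vy.
- move=> y v [Uy Vy].
  apply: (@cvg_comp _ _ _ (fun z : F * F => (f z.1, dirderiv z.2 f z.1))
    (fun z : E * E => dirderiv z.2 g z.1) _ (nbhs (f y, dirderiv v f y)));
    last exact: isC1_continuous gV Vy.
  apply: (@cvg_pair _ _ _ _ (nbhs (f y)) (nbhs (dirderiv v f y))).
    apply: (@cvg_comp _ _ _ fst f _ (nbhs y)).
      exact: (@cvg_fst _ _ (nbhs y) (nbhs v) _).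
    exact: isC_continuous fU Uy.
  exact: isC1_continuous fU Uy.
Qed.

Lemma has_dirderiv_pair (F E1 E2 : tvsType R) (f : F -> E1) (g : F -> E2) x v w1 w2 :
  has_dirderiv f x v w1 -> has_dirderiv g x v w2 ->
  has_dirderiv (fun y => (f y, g y)) x v (w1, w2).
Proof. by move=> h1 h2; exact: (@cvg_pair _ _ _ _ (nbhs w1) (nbhs w2) _ _ _ _ _ h1 h2). Qed.

Lemma C1at_pair (F E1 E2 : tvsType R) (f : F -> E1) (g : F -> E2) x :
  hausdorff_space E1 -> hausdorff_space E2 ->
  C1at f x -> C1at g x -> C1at (fun y => (f y, g y)) x.
Proof.
move=> h1 h2 [U [oU Ux fU]] [V [oV Vx gV]].
have oW : open (U `&` V) by exact: openI.
exists (U `&` V); split => //.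
apply: (isC1I (df := fun x v => (dirderiv v f x, dirderiv v g x))) => //.
- exact: hausdorff_prod.
- by move=> y v [Uy Vy]; apply: has_dirderiv_pair; [exact: isC1_has_dirderiv fU Uy|
    exact: isC1_has_dirderiv gV Vy].
- move=> y [Uy Vy]; apply: (@cvg_pair _ _ _ _ (nbhs (f y)) (nbhs (g y))).
    exact: isC_continuous fU Uy.
  exact: isC_continuous gV Vy.
- move=> y v [Uy Vy].
  apply: (@cvg_pair _ _ _ _ (nbhs (dirderiv v f y)) (nbhs (dirderiv v g y))).
    exact: isC1_continuous fU Uy.
  exact: isC1_continuous gV Vy.
Qed.

Lemma C1at_cst (F E : tvsType R) (w : E) (x : F) : hausdorff_space E ->
  C1at (fun=> w) x.
Proof.
move=> hE; apply: (@C1at_affine F E hE _ (fun=> 0)) => //; last 2 first.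
- by move=> y; exact: cvg_cst.
- by move=> y; exact: cvg_cst.
by move=> y v t; rewrite scaler0 addr0.
Qed.

Lemma C1at_id (F : tvsType R) (x : F) : hausdorff_space F -> C1at id x.
Proof. by move=> hF; apply: (@C1at_affine F F hF _ id) => // y; exact: cvg_id. Qed.

Lemma C1at_fst (F1 F2 : tvsType R) (x : F1 * F2) : hausdorff_space F1 -> C1at fst x.
Proof.
by move=> hF; apply: (@C1at_affine _ F1 hF _ fst) => // -[y z];
  exact: (@cvg_fst _ _ (nbhs y) (nbhs z) _).
Qed.

Lemma C1at_snd (F1 F2 : tvsType R) (x : F1 * F2) : hausdorff_space F2 -> C1at snd x.
Proof.
by move=> hF; apply: (@C1at_affine _ F2 hF _ snd) => // -[y z];
  exact: (@cvg_snd _ _ (nbhs y) (nbhs z) _).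
Qed.

Lemma Ro_hausdorff : hausdorff_space R^o.
Proof. exact: (@Rhausdorff R). Qed.

Lemma aff_continuous (al c : R) : continuous (fun s : R^o => al + c * s : R^o).
Proof.
move=> x; apply: (@cvgD_tvs R R^o); first exact: cvg_cst.
by apply: (@cvgZ_tvs R R^o); [exact: cvg_cst|exact: cvg_id].
Qed.

Lemma C1at_aff (al c : R) (x : R^o) : C1at (fun s : R^o => al + c * s : R^o) x.
Proof.
apply: (@C1at_affine _ R^o Ro_hausdorff _ (fun v : R^o => c * v : R^o)).
- by move=> y v a; rewrite -![_ *: _]/(_ * _) mulrDr addrA mulrCA.
- exact: aff_continuous.
- by move=> y; apply: (@cvgZ_tvs R R^o); [exact: cvg_cst|exact: cvg_id].
Qed.

Lemma cvg_mull_dnbhs0 (a : R) : a != 0 -> a * t @[t --> 0^'] --> (0 : R)^'.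
Proof.
move=> a0 B /nbhs_ballP[e /= e0 eB]; apply/nbhs_ballP.
exists (e / `|a|) => /=; first by rewrite divr_gt0// normr_gt0.
move=> h; rewrite /ball /= sub0r normrN => he h0; apply: eB.
  by rewrite /ball /= sub0r normrN normrM mulrC -ltr_pdivlMr// normr_gt0.
by rewrite mulf_neq0.
Qed.

Lemma has_dirderivZ (F E : tvsType R) (f : F -> E) x v w (a : R) :
  a != 0 -> has_dirderiv f x v w -> has_dirderiv f x (a *: v) (a *: w).
Proof.
move=> a0 fw.
have {}fw := cvg_comp _ _ (cvg_mull_dnbhs0 a0) fw.
have ha : cst a t @[t --> (0 : R)^'] --> a by exact: cvg_cst.
have h : a *: diffquot f x v (a * t) @[t --> (0 : R)^'] --> a *: w.
  exact: (cvgZ_tvs ha fw).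
apply: cvg_trans h; apply: near_eq_cvg; apply: nearW => t /=.
rewrite /diffquot [t *: (a *: v)]scalerA [t * a]mulrC scalerA.
by rewrite invfM mulrA divff// mul1r.
Qed.

Lemma dirderivZ (F E : tvsType R) (f : F -> E) x v (a : R) : hausdorff_space E ->
  a != 0 -> C1at f x -> dirderiv (a *: v) f x = a *: dirderiv v f x.
Proof.
move=> hE a0 fx; apply: (cvg_diffquot_unique hE).
by apply: has_dirderivZ => //; exact: C1at_dirderiv.
Qed.

End LocalC1.

(** * Differentiable maps into the group *)

Section GroupValued.
Context {R : realType} {E : tvsType R} {G : lieGroup E}.
Local Notation charts := (maximal_atlas (lg_atlas G)).
Local Notation hE := (model_hausdorff G).

(** All charts of the maximal atlas are allowed: the unit chart need not belong
    to the given atlas. By [C1Mat_chart] a single chart suffices. *)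
Definition C1Mat (F : tvsType R) (f : F -> G) (x : F) : Prop :=
  (\forall y \near x, {for y, continuous f}) /\
  (forall c, charts c -> cdom c (f x) -> C1at (c \o f) x).

Lemma open_preimage_on (T S : topologicalType) (f : T -> S) U V :
  open U -> open V -> (forall x, U x -> {for x, continuous f}) ->
  open (U `&` f @^-1` V).
Proof.
move=> oU oV fU; rewrite openE => x [Ux Vx]; apply: filterI.
  exact: open_nbhs_nbhs.
by apply: (fU x Ux); exact: open_nbhs_nbhs.
Qed.

Lemma transition_C1at (c c' : chart G E) y : smooth_transition c c' ->
  ccod c y -> cdom c' (cinv c y) -> C1at (c' \o cinv c) y.
Proof.
move=> cc' cy c'y; apply: (isC_C1at _ _ (cc' 1%N)); last by split.
apply: open_preimage_on; [exact: ccod_open|exact: cdom_open|].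
exact: cinv_continuous.
Qed.

Lemma atlas_charts (c : chart G E) : lg_atlas G c -> charts c.
Proof. by move=> Ac c' Ac'; exact: (lg_atlasP G).2. Qed.

Lemma chart_at (x : G) : exists c, [/\ lg_atlas G c, charts c & cdom c x].
Proof.
by have [c Ac cx] := (lg_atlasP G).1 x; exists c; split => //; exact: atlas_charts.
Qed.

Lemma near_cdom (T : topologicalType) (f : T -> G) x (c : chart G E) :
  {for x, continuous f} -> cdom c (f x) -> \forall y \near x, cdom c (f y).
Proof.
by move=> fc cx; apply: fc; apply: open_nbhs_nbhs; split => //; exact: cdom_open.
Qed.

(** Two charts of the maximal atlas need not be directly compatible by
    definition; the change of charts passes through a chart of the atlas. *)
Lemma C1Mat_chart (F : tvsType R) (f : F -> G) x c :
  (\forall y \near x, {for y, continuous f}) -> charts c -> cdom c (f x) ->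
  C1at (c \o f) x -> C1Mat f x.
Proof.
move=> fc mc cx cfx; split => // c' mc' c'x.
have fx := nbhs_singleton fc.
have [a [Aa ma ax]] := chart_at (f x).
have afx : C1at (a \o f) x.
  apply: (C1at_eq_near hE (f := (a \o cinv c) \o (c \o f))).
    by apply: filterS (near_cdom fx cx) => y cy /=; rewrite cmapK.
  apply: C1at_comp => //; first exact: hE.
  apply: transition_C1at; [exact: (mc a Aa).1|exact: cmap_cod|].
  by rewrite /= cmapK.
apply: (C1at_eq_near hE (f := (c' \o cinv a) \o (a \o f))).
  by apply: filterS (near_cdom fx ax) => y ay /=; rewrite cmapK.
apply: C1at_comp => //; first exact: hE.
apply: transition_C1at; [exact: (mc' a Aa).2|exact: cmap_cod|].
by rewrite /= cmapK.
Qed.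

Lemma C1Mat_isCM (F : tvsType R) (f : F -> G) U x : open U -> U x ->
  isCM (lg_atlas G) 1 U f -> C1Mat f x.
Proof.
move=> oU Ux [fc fU]; have [c [Ac mc cx]] := chart_at (f x).
apply: (C1Mat_chart (c := c)) => //.
  by apply: filterS (open_nbhs_nbhs (conj oU Ux)) => y; exact: fc.
apply: isC_C1at (fU c Ac) => //.
by apply: open_preimage_on => //; exact: cdom_open.
Qed.

Lemma C1Mat_continuous (F : tvsType R) (f : F -> G) x : C1Mat f x -> {for x, continuous f}.
Proof. by case=> /nbhs_singleton. Qed.

Lemma isCM_C1Mat (F : tvsType R) (f : F -> G) U : open U ->
  (forall x, U x -> C1Mat f x) -> isCM (lg_atlas G) 1 U f.
Proof.
move=> oU fU; split=> [x /fU|c Ac]; first exact: C1Mat_continuous.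
apply: C1at_isC; first exact: hE.
  apply: open_preimage_on => //; first exact: cdom_open.
  by move=> x /fU; exact: C1Mat_continuous.
by move=> x [/fU fx cx]; apply: fx.2 => //; exact: atlas_charts.
Qed.

Lemma C1Mat_near (F : tvsType R) (f : F -> G) x : C1Mat f x -> \forall y \near x, C1Mat f y.
Proof.
move=> fx; have [c [Ac mc cx]] := chart_at (f x).
have fc := near_join fx.1; have cf := C1at_near (fx.2 c mc cx).
have cn := near_cdom (C1Mat_continuous fx) cx.
by apply: filterS3 fc cf cn => y *; exact: (C1Mat_chart (c := c)).
Qed.

Lemma C1Mat_comp (F F' : tvsType R) (f : F -> G) (u : F' -> F) x :
  C1Mat f (u x) -> C1at u x -> C1Mat (f \o u) x.
Proof.
move=> fu ux; have [c [Ac mc cx]] := chart_at (f (u x)).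
apply: (C1Mat_chart (c := c)) => //; last first.
  exact: (C1at_comp (g := c \o f) hE ux (fu.2 c mc cx)).
have un := C1at_near ux.
have fn := C1at_continuous ux fu.1.
by apply: filterS2 un fn => y uy fy; apply: continuous_comp => //; exact: C1at_continuous.
Qed.

Lemma C1Mat_eq_near (F : tvsType R) (f g : F -> G) x :
  (\forall y \near x, f y = g y) -> C1Mat f x -> C1Mat g x.
Proof.
move=> fg fx; have fgx := nbhs_singleton fg.
have [c [Ac mc cx]] := chart_at (f x).
apply: (C1Mat_chart (c := c)); rewrite -?fgx//.
  apply: filterS2 (near_join fg) fx.1 => y fgy fy.
  rewrite /prop_for /continuous_at -(nbhs_singleton fgy).
  by apply: cvg_trans fy; exact: near_eq_cvg fgy.
apply: (C1at_eq_near hE (f := c \o f)); last exact: fx.2.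
by apply: filterS fg => y /= ->.
Qed.

Lemma C1Mat_cinv (c : chart G E) y : charts c -> ccod c y -> C1Mat (cinv c) y.
Proof.
move=> mc cy; apply: (C1Mat_chart (c := c)) => //.
- apply: filterS (open_nbhs_nbhs (conj (@ccod_open _ _ _ c) cy)) => z.
  exact: cinv_continuous.
- exact: cinv_dom.
apply: (C1at_eq_near hE (f := id)); last by apply: C1at_id; exact: hE.
apply: filterS (open_nbhs_nbhs (conj (@ccod_open _ _ _ c) cy)) => z cz /=.
by rewrite cinvK.
Qed.

Lemma C1Mat_mul (F : tvsType R) (f g : F -> G) x : C1Mat f x -> C1Mat g x ->
  C1Mat (fun y => f y * g y)%g x.
Proof.
move=> fx gx.
have [c [Ac mc cx]] := chart_at (f x); have [d [Ad md dx]] := chart_at (g x).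
have oW : open (ccod c `*` ccod d).
  rewrite openE => -[y z] [cy dz]; exists (ccod c, ccod d) => /=; last by [].
  by split; apply: open_nbhs_nbhs; split => //; exact: ccod_open.
apply: (C1Mat_eq_near (f := (fun z : E * E => cinv c z.1 * cinv d z.2)%g \o
   (fun y => (c (f y), d (g y))))).
  apply: filterS2 (near_cdom (C1Mat_continuous fx) cx)
    (near_cdom (C1Mat_continuous gx) dx) => y cy dy /=.
  by rewrite !cmapK.
apply: C1Mat_comp; last first.
  by apply: C1at_pair; [exact: hE|exact: hE|exact: fx.2|exact: gx.2].
apply: (C1Mat_isCM oW _ (lg_mul_smooth Ac Ad 1)).
by split; exact: cmap_cod.
Qed.

Lemma C1Mat_inv (F : tvsType R) (f : F -> G) x : C1Mat f x ->
  C1Mat (fun y => (f y)^-1)%g x.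
Proof.
move=> fx; have [c [Ac mc cx]] := chart_at (f x).
apply: (C1Mat_eq_near (f := (fun y : E => (cinv c y)^-1)%g \o (c \o f))).
  by apply: filterS (near_cdom (C1Mat_continuous fx) cx) => y cy /=; rewrite cmapK.
apply: C1Mat_comp; last exact: fx.2.
apply: (C1Mat_isCM (@ccod_open _ _ _ c) _ (lg_inv_smooth Ac 1)).
exact: cmap_cod.
Qed.

Lemma C1Mat_cst (F : tvsType R) (g : G) (x : F) : C1Mat (fun=> g) x.
Proof.
have [c [Ac mc cx]] := chart_at g.
apply: (C1Mat_chart (c := c)) => //; last by apply: C1at_cst; exact: hE.
by apply: nearW => y; exact: cvg_cst.
Qed.

Lemma curve_atP (x : G) (gamma : R^o -> G) :
  curve_at x gamma <-> gamma 0 = x /\ C1Mat gamma 0.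
Proof.
split=> -[g0 g1]; split => //.
  have [e e0 ge] := g1; apply: C1Mat_isCM ge; first exact: open_oo.
  by rewrite /= oppr_lt0 e0.
have /nbhs_ballP[e /= e0 eg] := C1Mat_near g1; exists e => //.
apply: isCM_C1Mat; first exact: open_oo.
by move=> s /= se; apply: eg; rewrite /ball /= sub0r normrN ltr_norml.
Qed.

End GroupValued.

(** * Logarithmic derivatives in the unit chart *)

Section LogarithmicDerivative.
Context {R : realType} {E : tvsType R} {G : lieGroup E} (Xi : unitChart G).
Local Notation hE := (model_hausdorff G).
Local Notation ldX mu t := (@dXi R E G Xi (rlogder mu t)).
Implicit Types (mu nu : R^o -> G).

Lemma uchartV : cinv Xi 0 = 1%g.
Proof. by rewrite -(uchart1 Xi) cmapK//; exact: uchart_dom1. Qed.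

Lemma uchart_cod0 : ccod Xi 0.
Proof. by rewrite -(uchart1 Xi); apply: cmap_cod; exact: uchart_dom1. Qed.

Lemma has_dirderiv_shift (f : R^o -> E) (t : R^o) w :
  has_dirderiv (fun s => f (t + s)) 0 1 w <-> has_dirderiv f t 1 w.
Proof.
rewrite /has_dirderiv; suff -> : diffquot (fun s => f (t + s)) 0 1 = diffquot f t 1 by [].
by apply/funext => s; rewrite /diffquot add0r addr0.
Qed.

Lemma C1Mat_shift mu t : C1Mat mu t -> C1Mat (fun s => mu (t + s)) 0.
Proof.
move=> mt; have -> : (fun s => mu (t + s)) = mu \o (fun s : R^o => t + 1 * s : R^o).
  by apply/funext => s /=; rewrite mul1r.
by apply: C1Mat_comp; [rewrite /= mulr0 addr0|exact: C1at_aff].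
Qed.

(** The tangent vector [rlogder mu t] is defined by a representative of the
    velocity of [mu], chosen arbitrarily. Right translation by [(mu t)^-1] is
    differentiable, and the velocity of a translated curve depends only on the
    velocity of the curve, so the representative may be replaced by [mu]
    itself. *)
Lemma has_rlogder_chart mu t : C1Mat mu t ->
  has_dirderiv (fun s => Xi (mu (t + s) * (mu t)^-1)%g) 0 1 (ldX mu t).
Proof.
move=> mt; set g := (mu t)^-1%g; have [c [Ac mc cx]] := chart_at (mu t).
have gx : curve_at (mu t) (fun s => mu (t + s)).
  by apply/curve_atP; split; [rewrite addr0|exact: C1Mat_shift].
pose f (y : E) := Xi (cinv c y * g)%g.
have fc : C1at f (c (mu t)).
  have hm : C1Mat (fun y : E => cinv c y * g)%g (c (mu t)).
    apply: C1Mat_mul; last exact: C1Mat_cst.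
    by apply: C1Mat_cinv => //; exact: cmap_cod.
  apply: hm.2; first exact: uchart_max.
  by rewrite cmapK// mulgV; exact: uchart_dom1.
have vel z : curve_at (mu t) z -> has_dirderiv (fun s => Xi (z s * g)%g) 0 1
    (dirderiv (chart_velocity c z 0) f (c (mu t))).
  move=> zx; have := curve_has_velocity zx Ac cx => zv.
  have fz : C1at f ((c \o z) 0) by rewrite /= zx.1.
  have := C1at_chain fz zv; rewrite /= zx.1; apply: near_dirderiv.
  have z0 : cdom c (z 0) by rewrite zx.1.
  apply: filterS (near_cdom (curve_continuous zx) z0) => s cs.
  by rewrite /f /= cmapK.
set eta := trep (velocity mu t).
have ex : curve_at (mu t) eta by exact: trep_curve.
have egx : curve_at 1%g ((fun h => h * g)%g \o eta).
  apply/curve_atP; split; first by rewrite /= ex.1 mulgV.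
  by apply: C1Mat_mul; [exact: ((curve_atP _ _).1 ex).2|exact: C1Mat_cst].
have -> : ldX mu t = dirderiv (chart_velocity c (fun s => mu (t + s)) 0) f (c (mu t)).
  rewrite (trep_tvec gx Ac cx) /dXi /rlogder /tangent_map.
  rewrite (dchart_tvec (uchart_max Xi) (uchart_dom1 Xi) egx).
  by apply: cvg_diffquot_unique; [exact: hE|exact: vel].
exact: vel.
Qed.

Lemma rlogder_unique mu t w : C1Mat mu t ->
  has_dirderiv (fun s => Xi (mu (t + s) * (mu t)^-1)%g) 0 1 w -> ldX mu t = w.
Proof.
move=> mt h; rewrite -(cvg_diffquot_unique hE h).
by rewrite (cvg_diffquot_unique hE (has_rlogder_chart mt)).
Qed.

(** [rlogder mu s] is the derivative in direction [(1, 0)] at the diagonal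
    point [(s, s)] of the map [(s, u) |-> Xi (mu s * (mu u)^-1)], which is of
    class C^1 near the diagonal. *)
Lemma rlogder_continuous mu t : C1Mat mu t ->
  {for t, continuous (fun s : R^o => ldX mu s)}.
Proof.
move=> mt.
pose P (z : R^o * R^o) := Xi (mu z.1 * (mu z.2)^-1)%g.
have Pt : C1at P (t, t).
  have hm : C1Mat (fun z : R^o * R^o => mu z.1 * (mu z.2)^-1)%g (t, t).
    apply: C1Mat_mul; first by apply: (C1Mat_comp (f := mu)) => //; apply: C1at_fst; exact: Ro_hausdorff.
    apply: C1Mat_inv; apply: (C1Mat_comp (f := mu)) => //; apply: C1at_snd; exact: Ro_hausdorff.
  apply: hm.2; first exact: uchart_max.
  by rewrite /= mulgV; exact: uchart_dom1.
have diag : ((s, s) : R^o * R^o) @[s --> t] --> ((t, t) : R^o * R^o).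
  by apply: (@cvg_pair _ _ _ _ (nbhs t) (nbhs t)); exact: cvg_id.
(* The diagonal derivative of P recovers the logarithmic derivative near t. *)
have X1 : \forall s \near t, dirderiv ((1, 0) : R^o * R^o) P (s, s) = ldX mu s.
  apply: filterS2 (C1Mat_near mt) (diag _ (C1at_near Pt)) => s ms Ps.
  apply/esym/rlogder_unique => //.
  have := C1at_dirderiv (v := ((1, 0) : R^o * R^o)) Ps.
  rewrite /has_dirderiv; suff -> : diffquot P (s, s) (1, 0) =
    diffquot (fun s' => Xi (mu (s + s') * (mu s)^-1)%g) 0 1 by [].
  apply/funext => u; rewrite /diffquot /P /=.
  by rewrite scaler0 !addr0 add0r.
rewrite /prop_for /continuous_at -(nbhs_singleton X1).
apply: cvg_trans; first exact: near_eq_cvg X1.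
have sP : (((s, s), (1, 0)) : (R^o * R^o) * (R^o * R^o)) @[s --> t] -->
    (((t, t), (1, 0)) : (R^o * R^o) * (R^o * R^o)).
  apply: (@cvg_pair _ _ _ _ (nbhs ((t, t) : R^o * R^o)) (nbhs ((1, 0) : R^o * R^o))) => //.
  exact: cvg_cst.
exact: (cvg_comp _ _ sP (C1at_dirderiv_continuous (v := ((1, 0) : R^o * R^o)) Pt)).
Qed.

Definition chart_mul (z : E * E) : E := Xi (cinv Xi z.1 * cinv Xi z.2)%g.

(** The right-invariant vector field of the tangent vector [v], read in the
    unit chart at the point [y]. *)
Definition chart_field (y v : E) : E := dirderiv ((v, 0) : E * E) chart_mul (0, y).

Lemma chart_mul_C1at y : ccod Xi y -> C1at chart_mul (0, y).
Proof.
move=> cy; have hm : C1Mat (fun z : E * E => cinv Xi z.1 * cinv Xi z.2)%g (0, y).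
  apply: C1Mat_mul.
    apply: (C1Mat_comp (f := cinv Xi)); last by apply: C1at_fst; exact: hE.
    by apply: C1Mat_cinv; [exact: uchart_max|exact: uchart_cod0].
  apply: (C1Mat_comp (f := cinv Xi)); last by apply: C1at_snd; exact: hE.
  by apply: C1Mat_cinv => //; exact: uchart_max.
apply: hm.2; first exact: uchart_max.
by rewrite /= uchartV mul1g; exact: cinv_dom.
Qed.

Lemma chart_field0 v : chart_field 0 v = v.
Proof.
apply: cvg_diffquot_unique; first exact: hE.
have h : cst v t @[t --> (0 : R)^'] --> v by exact: cvg_cst.
apply: cvg_trans h; apply: near_eq_cvg.
have L0 : (0 + t *: v) @[t --> (0 : R)] --> (0 : E) by exact: cvg_line.
have := nbhs_dnbhs (L0 _ (open_nbhs_nbhs (conj (@ccod_open _ _ _ Xi) uchart_cod0))).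
apply: filterS2 (nbhs_dnbhs_neq (0 : R)) => t t0 /= ct.
rewrite /diffquot /chart_mul /= scaler0 addr0 uchartV !mulg1 cinvK//.
by rewrite uchart1 subr0 add0r scalerA mulVf// scale1r.
Qed.

Lemma chart_fieldZ y v (a : R) : a != 0 -> ccod Xi y ->
  chart_field y (a *: v) = a *: chart_field y v.
Proof.
move=> a0 cy; rewrite /chart_field -(dirderivZ _ hE a0 (chart_mul_C1at cy)).
suff -> : a *: ((v, 0) : E * E) = (a *: v, 0) by [].
by rewrite -[LHS]/(a *: v, a *: (0 : E)) scaler0.
Qed.

Lemma chart_field_continuous y v : ccod Xi y ->
  {for (y, v), continuous (fun z : E * E => chart_field z.1 z.2)}.
Proof.
move=> cy.
apply: (@cvg_comp _ _ _ (fun z : E * E => ((0, z.1), (z.2, 0)) : (E * E) * (E * E))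
  (fun z => dirderiv z.2 chart_mul z.1) _ (nbhs ((0, y), (v, 0)))); last first.
  by apply: C1at_dirderiv_continuous; exact: chart_mul_C1at.
apply: (@cvg_pair _ _ _ _ (nbhs ((0, y) : E * E)) (nbhs ((v, 0) : E * E))).
  apply: (@cvg_pair _ _ _ _ (nbhs (0 : E)) (nbhs y)); first exact: cvg_cst.
  exact: (@cvg_fst _ _ (nbhs y) (nbhs v) _).
apply: (@cvg_pair _ _ _ _ (nbhs v) (nbhs (0 : E))); last exact: cvg_cst.
exact: (@cvg_snd _ _ (nbhs y) (nbhs v) _).
Qed.

Lemma near_quotient mu t : C1Mat mu t -> \forall s \near (0 : R^o),
  cdom Xi (mu (t + s) * (mu t)^-1)%g.
Proof.
move=> mt; apply: near_cdom; last first.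
  by rewrite addr0 mulgV; exact: uchart_dom1.
apply: C1Mat_continuous; apply: C1Mat_mul; [exact: C1Mat_shift|exact: C1Mat_cst].
Qed.

(** Near [t] one has [mu s * g = (mu s * (mu t)^-1) * (mu t * g)], and the
    first factor has velocity [rlogder mu t] at the unit. *)
Lemma chart_equation mu t g : C1Mat mu t -> cdom Xi (mu t * g)%g ->
  has_dirderiv (fun s => Xi (mu s * g)%g) t 1
    (chart_field (Xi (mu t * g)%g) (ldX mu t)).
Proof.
move=> mt mg; apply/has_dirderiv_shift.
set y := Xi (mu t * g)%g; have cy : ccod Xi y by exact: cmap_cod.
pose u (s : R^o) : E * E := (Xi (mu (t + s) * (mu t)^-1)%g, y).
have u0 : u 0 = (0, y) by rewrite /u addr0 mulgV uchart1.
have fu : C1at chart_mul (u 0) by rewrite u0; exact: chart_mul_C1at.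
have uv : has_dirderiv u 0 1 (ldX mu t, 0).
  apply: has_dirderiv_pair; first exact: has_rlogder_chart.
  have h : cst (0 : E) s @[s --> (0 : R)^'] --> (0 : E) by exact: cvg_cst.
  by apply: cvg_trans h; apply: near_eq_cvg; apply: nearW => s; rewrite /diffquot subrr scaler0.
have := C1at_chain fu uv; rewrite u0; apply: near_dirderiv.
apply: filterS (near_quotient mt) => s cs; rewrite /= /chart_mul /u /y /=.
by rewrite !cmapK// divgKA.
Qed.

(** Write [(nu s)^-1 * mu s = (nu t)^-1 * (b^-1 * a) * mu t] with [a = mu s *
    (mu t)^-1] and [b = nu s * (nu t)^-1]. Both [a] and [b] leave the unit with
    the same velocity [X]. The map [(x, y) |-> x^-1 * y] is constant on the
    diagonal, so its derivative in direction [(X, X)] vanishes. *)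
Lemma quotient_flat mu nu t c : C1Mat mu t -> C1Mat nu t -> ldX mu t = ldX nu t ->
  maximal_atlas (lg_atlas G) c -> cdom c ((nu t)^-1 * mu t)%g ->
  has_dirderiv (fun s => c ((nu s)^-1 * mu s)%g) t 1 0.
Proof.
move=> mt nt mn mc cx; apply/has_dirderiv_shift.
pose m (z : E * E) := ((nu t)^-1 * ((cinv Xi z.1)^-1 * cinv Xi z.2) * mu t)%g.
pose u (s : R^o) : E * E := (Xi (nu (t + s) * (nu t)^-1)%g, Xi (mu (t + s) * (mu t)^-1)%g).
have u0 : u 0 = (0, 0) by rewrite /u addr0 !mulgV uchart1.
have m0 : C1Mat m (0, 0).
  have iC : C1Mat (cinv Xi) 0 by apply: C1Mat_cinv; [exact: uchart_max|exact: uchart_cod0].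
  apply: C1Mat_mul; last exact: C1Mat_cst.
  apply: C1Mat_mul; first exact: C1Mat_cst.
  apply: C1Mat_mul; first apply: C1Mat_inv.
    by apply: (C1Mat_comp (f := cinv Xi)) => //; apply: C1at_fst; exact: hE.
  by apply: (C1Mat_comp (f := cinv Xi)) => //; apply: C1at_snd; exact: hE.
have cm : C1at (c \o m) (0, 0).
  by apply: m0.2 => //; rewrite /m /= uchartV mulVg mulg1.
have uv : has_dirderiv u 0 1 (ldX mu t, ldX mu t).
  apply: has_dirderiv_pair; last exact: has_rlogder_chart.
  by rewrite mn; exact: has_rlogder_chart.
(* The composite is constant along the diagonal. *)
have d0 : dirderiv ((ldX mu t, ldX mu t) : E * E) (c \o m) (0, 0) = 0.
  apply: cvg_diffquot_unique; first exact: hE.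
  have h : cst (0 : E) s @[s --> (0 : R)^'] --> (0 : E) by exact: cvg_cst.
  apply: cvg_trans h; apply: near_eq_cvg; apply: nearW => s.
  by rewrite /diffquot /m /= !add0r !mulVg subrr scaler0.
have := C1at_chain (s := 0) (u := u) (f := c \o m); rewrite u0 => /(_ _ cm uv).
rewrite d0; apply: near_dirderiv.
apply: filterS2 (near_quotient mt) (near_quotient nt) => s ms ns.
rewrite /= /m /u /= !cmapK// invgF.
by rewrite !mulgA mulVg mul1g -!mulgA mulVg mulg1.
Qed.

End LogarithmicDerivative.

(** * A curve is determined by its logarithmic derivative *)

Section Uniqueness.
Context {R : realType} {E : tvsType R}.

(** The form of [convex_mean_value] for an arbitrary segment. *)
Lemma mean_value_on (C : set E) (u : R^o -> E) (a b : R) : a < b ->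
  convex_set C -> open C ->
  (forall s : R, a <= s <= b -> exists2 w, C w & has_dirderiv u s 1 w) ->
  C ((b - a)^-1 *: (u b - u a)).
Proof.
move=> ab cC oC uC; have ba0 : b - a != 0 by rewrite subr_eq0 gt_eqF.
pose v (s : R) := (b - a)^-1 *: u (a + (b - a) * s).
have -> : (b - a)^-1 *: (u b - u a) = v 1 - v 0.
  by rewrite /v mulr1 mulr0 addr0 [a + _]addrC subrK scalerBr.
apply: convex_mean_value => // s /andP[s0 s1].
have [|w Cw uw] := uC (a + (b - a) * s).
  by apply/andP; split; nra.
exists w => //; have := cvg_comp _ _ (cvg_mull_dnbhs0 ba0) uw.
apply: cvg_trans; apply: near_eq_cvg; apply: nearW => h /=.
have e : a + (b - a) * (s + h) = a + (b - a) * s + (b - a) * h.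
  by rewrite mulrDr addrA.
rewrite /diffquot /v e -scalerBr scalerA -invfM [h * _]mulrC.
by rewrite -[((b - a) * h) *: 1]/(((b - a) * h) * 1) [_ * 1]mulr1.
Qed.

Lemma tvs_nbhs0_eq0 (x : E) : hausdorff_space E ->
  (forall W, nbhs 0 W -> W x) -> x = 0.
Proof.
move=> hE xW; apply: hE => A B xA B0; exists x; split; first exact: nbhs_singleton xA.
exact: xW.
Qed.

Lemma flat_constant (u : R^o -> E) (a b : R) : hausdorff_space E ->
  (forall s : R, a <= s <= b -> has_dirderiv u s 1 0) -> a <= b -> u a = u b.
Proof.
move=> hE u0; rewrite le_eqVlt => /orP[/eqP->//|ab].
have ba0 : b - a != 0 by rewrite subr_eq0 gt_eqF.
suff : (b - a)^-1 *: (u b - u a) = 0.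
  move/(congr1 ( *:%R (b - a))); rewrite scalerA divff// scale1r scaler0.
  by move/eqP; rewrite subr_eq0 => /eqP.
apply: tvs_nbhs0_eq0 => // W /tvs_convex_nbhs[C [cC oC C0 CW]]; apply: CW.
by apply: (@mean_value_on C u) => // s sab; exists 0 => //; exact: u0.
Qed.

Context {G : lieGroup E} (Xi : unitChart G).
Local Notation hE := (model_hausdorff G).

(** Connectedness of the segment. *)
Lemma locally_constant_segment (T : Type) (f : R -> T) (a b : R) : a <= b ->
  (forall t : R, a <= t <= b -> \forall s \near t, a <= s <= b -> f s = f t) ->
  f b = f a.
Proof.
move=> ab loc.
pose A := [set t : R | a <= t <= b].
have AE : A = [set` `[a, b]] by apply/seteqP; split => t; rewrite /A /= in_itv.
have cA : connected A by rewrite AE; exact: segment_connected.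
have Aa : A a by rewrite /A /= lexx.
have Ab : A b by rewrite /A /= ab lexx.
suff : A `&` [set t | f t = f a] = A by move/seteqP => -[_ /(_ b Ab) []].
apply: cA; first by exists a.
  exists [set t | A t -> f t = f a]°; first exact: open_interior.
  apply/seteqP; split => t [At h]; split => //; last first.
    by have := nbhs_singleton h; exact.
  by move: (loc t At); apply: filterS => s sA As; rewrite sA.
exists (~` [set t | A t -> f t <> f a]°); first by apply: open_closedC; exact: open_interior.
apply/seteqP; split => t [At h]; split => //.
  by move=> /nbhs_singleton; exact.
apply: contrapT => ft; apply: h.
by move: (loc t At); apply: filterS => s sA As; rewrite sA.
Qed.

Lemma rlogder_eq_evol (mu nu : R^o -> G) (a b : R) : a <= b ->
  (forall t : R, a <= t <= b ->
     [/\ C1Mat mu t, C1Mat nu t & rlogder mu t = rlogder nu t]) ->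
  (mu b * (mu a)^-1)%g = (nu b * (nu a)^-1)%g.
Proof.
move=> ab munu.
pose k (t : R) := ((nu t)^-1 * mu t)%g.
have kc (t : R) : a <= t <= b -> C1Mat (k : R^o -> G) t.
  by move=> /munu[mt nt _]; apply: C1Mat_mul => //; exact: C1Mat_inv.
suff kE : k b = k a.
  have -> : mu b = (nu b * k b)%g by rewrite /k mulgA mulgV mul1g.
  by rewrite kE /k -!mulgA mulgV mulg1.
apply: locally_constant_segment => // t tab.
have [c [Ac mc cx]] := chart_at (k t).
have /nbhs_ballP[e /= e0 ce] := near_cdom (C1Mat_continuous (kc t tab)) cx.
apply/nbhs_ballP; exists e => //= s; rewrite /ball /= => ts sab.
have cs : cdom c (k s) by apply: ce.
have flat (x y : R) : x <= y -> a <= x <= b -> a <= y <= b -> `|t - x| < e ->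
    `|t - y| < e -> c (k x) = c (k y).
  move=> xy /andP[ax xb] /andP[ay yb] tx ty.
  apply: (@flat_constant (c \o k)) => // [|z /andP[xz zy]]; first exact: hE.
  have zab : a <= z <= b by rewrite (le_trans ax) //= (le_trans zy).
  have [mz nz mn] := munu z zab.
  apply: (@quotient_flat _ _ _ Xi) => //; first by rewrite mn.
  apply: ce; rewrite /ball /= ltr_norml; move: tx ty; rewrite !ltr_norml.
  by move=> /andP[? ?] /andP[? ?]; apply/andP; split; lra.
have tt0 : `|t - t| < e by rewrite subrr normr0.
have kst : c (k s) = c (k t).
  by have [st|st] := leP s t; [exact: flat|apply/esym/flat => //; exact: ltW].
by rewrite -(cmapK cs) kst cmapK.
Qed.

End Uniqueness.

(** * Affine reparametrization *)

Section AffineReparametrization.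
Context {R : realType} {E : tvsType R}.
Hypothesis hE : hausdorff_space E.
Implicit Types (f : R^o -> E).

Lemma has_dirderiv_aff f (al c d : R) (x v : R^o) w : c != 0 ->
  has_dirderiv f (al + c * x : R^o) v w ->
  has_dirderiv (fun s : R^o => d *: f (al + c * s)) x v ((d * c) *: w).
Proof.
move=> c0 fw; have {}fw := cvg_comp _ _ (cvg_mull_dnbhs0 c0) fw.
have ha : cst (d * c) t @[t --> (0 : R)^'] --> d * c by exact: cvg_cst.
have h : (d * c) *: diffquot f (al + c * x : R^o) v (c * t) @[t --> (0 : R)^'] --> (d * c) *: w.
  exact: (cvgZ_tvs ha fw).
apply: cvg_trans h; apply: near_eq_cvg; apply: nearW => t.
have e : al + c * (x + t * v) = al + c * x + (c * t) * v by rewrite mulrDr addrA mulrA.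
rewrite /diffquot -[t *: v]/(t * v) -[(c * t) *: v]/((c * t) * v) e -scalerBr !scalerA.
by congr (_ *: _); rewrite invfM mulrA mulfK// mulrC.
Qed.

(** When the derivative of [f] does not exist neither does that of the
    reparametrized map, and both sides take the default value [0]. *)
Lemma dirderiv_aff f (al c d : R) (x v : R^o) : c != 0 -> d != 0 ->
  dirderiv v (fun s : R^o => d *: f (al + c * s)) x =
  (d * c) *: dirderiv v f (al + c * x : R^o).
Proof.
move=> c0 d0; set g := (fun s : R^o => _).
have [[w fw]|nf] := pselect (exists w, has_dirderiv f (al + c * x : R^o) v w).
  rewrite (cvg_diffquot_unique hE fw); apply: cvg_diffquot_unique => //.
  exact: has_dirderiv_aff.
rewrite /dirderiv [X in _ *: X]xgetPN ?scaler0; last by move=> w fw; apply: nf; exists w.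
apply: xgetPN => w gw; apply: nf; exists ((d^-1 * c^-1) *: w).
have -> : f = fun s : R^o => d^-1 *: g (- (al / c) + c^-1 * s).
  apply/funext => s; rewrite /g scalerA mulVf// scale1r; congr f.
  by field.
apply: has_dirderiv_aff; first by rewrite invr_neq0.
by have -> : - (al / c) + c^-1 * (al + c * x) = x by field.
Qed.

Lemma dirderivs_aff f (al c d : R) (vs : seq R^o) (x : R^o) : c != 0 -> d != 0 ->
  dirderivs vs (fun s : R^o => d *: f (al + c * s)) x =
  (d * c ^+ size vs) *: dirderivs vs f (al + c * x : R^o).
Proof.
move=> c0; elim: vs f d => [|v vs IH] f d d0 /=; first by rewrite expr0 mulr1.
rewrite exprS mulrA -(IH (dirderiv v f)) ?mulf_neq0//; congr (dirderivs vs _ x).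
by apply/funext => s; exact: dirderiv_aff.
Qed.

Lemma scale_map_fst_continuous (T1 T2 : topologicalType) (f : T1 -> T1)
    (g : T1 * T2 -> E) x (v : T2) (a : R) : {for x, continuous f} ->
  {for (f x, v), continuous g} ->
  {for (x, v), continuous (fun z : T1 * T2 => a *: g (f z.1, z.2))}.
Proof.
move=> fx gfx.
have fv : (f z.1, z.2) @[z --> (x, v)] --> (f x, v).
  apply: (@cvg_pair _ _ _ _ (nbhs (f x)) (nbhs v)).
    exact: (cvg_comp _ _ (@cvg_fst _ _ (nbhs x) (nbhs v) _) fx).
  exact: (@cvg_snd _ _ (nbhs x) (nbhs v) _).
by apply: cvgZ_tvs; [exact: cvg_cst|exact: cvg_comp fv gfx].
Qed.

(** The dilation factor [c] is taken out of each derivative by [dirderivs_aff],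
    so that the continuity condition for [f] applies with unchanged directions.
    *)
Lemma isC_aff k U f (al c d : R) : c != 0 -> d != 0 -> isC k U f ->
  isC k ((fun s : R^o => al + c * s : R^o) @^-1` U)
    (fun s : R^o => d *: f (al + c * s)).
Proof.
move=> c0 d0 [fd fc]; split=> [x vs v Ux vsk|p x v pk Ux].
  have [w fw] := fd _ vs v Ux vsk; exists ((d * c ^+ size vs * c) *: w).
  have -> : dirderivs vs (fun s : R^o => d *: f (al + c * s)) =
    (fun s : R^o => (d * c ^+ size vs) *: dirderivs vs f (al + c * s : R^o)).
    by apply/funext => s; exact: dirderivs_aff.
  exact: has_dirderiv_aff.
have := fc p (al + c * x : R^o) v pk Ux.
set g := (X in {for _, continuous X}) => gc.
have -> : (fun z : R^o * {ptws 'I_p -> R^o} =>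
    dirderivs [seq z.2 i | i : 'I_p] (fun s : R^o => d *: f (al + c * s)) z.1) =
  (fun z => (d * c ^+ p) *: g ((al + c * z.1 : R^o), z.2)).
  apply/funext => z; rewrite dirderivs_aff//.
  by rewrite size_map -cardE card_ord.
clearbody g.
exact: (@scale_map_fst_continuous (R^o : topologicalType) {ptws 'I_p -> R^o} (fun s : R^o => al + c * s : R^o) g x v (d * c ^+ p) (@aff_continuous R al c x) gc).
Qed.

Lemma dirderivs_continuous n m U f x : isC n U f -> (m <= n)%N -> U x ->
  {for x, continuous (dirderivs (nseq m (1 : R^o)) f)}.
Proof.
move=> [_ fc] mn Ux; have := fc m x (fun=> 1) mn Ux.
set g := (X in {for _, continuous X}) => gc.
have -> : dirderivs (nseq m (1 : R^o)) f =
    (fun s : R^o => g (s, (fun=> 1) : {ptws 'I_m -> R^o})).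
  apply/funext => s; rewrite /g /=; congr (dirderivs _ f s).
  have cst_map (l : seq 'I_m) : [seq (1 : R^o) | _ <- l] = nseq (size l) (1 : R^o).
    by elim: l => //= i l ->.
  by rewrite /image_mem cst_map size_enum_ord.
apply: (@cvg_comp _ _ _ (fun s : R^o => (s, (fun=> 1) : {ptws 'I_m -> R^o}))
   g _ (nbhs (x, (fun=> 1) : {ptws 'I_m -> R^o}))); last exact: gc.
apply: (@cvg_pair _ _ _ _ (nbhs x) (nbhs ((fun=> 1) : {ptws 'I_m -> R^o})));
  [exact: cvg_id|exact: cvg_cst].
Qed.

End AffineReparametrization.

(** * Evolution of reparametrized curves *)

Section Evolution.
Context {R : realType} {E : tvsType R} {G : lieGroup E} (Xi : unitChart G).
Local Notation hE := (model_hausdorff G).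
Local Notation g := (lieAlg Xi).
Implicit Types (phi psi : R^o -> g) (mu nu : R^o -> G).

Lemma lieAlg_hausdorff : hausdorff_space g.
Proof.
move=> X Y XY; apply: (can_inj (@dXiK _ _ _ Xi)); apply: hE => A B XA YB.
have [] := XY (@dXi _ _ _ Xi @^-1` A) (@dXi _ _ _ Xi @^-1` B).
- exact: (@dXi_continuous _ _ _ Xi X).
- exact: (@dXi_continuous _ _ _ Xi Y).
by move=> Z [ZA ZB]; exists (dXi Z).
Qed.

Lemma dXi0 : dXi (0 : g) = 0.
Proof. by have := dXiZ 0 (0 : g); rewrite !scale0r. Qed.

Lemma curveG_C1Mat (r r' : R) mu : curveG r r' mu ->
  forall t : R, r <= t <= r' -> C1Mat mu t.
Proof.
move=> [a [b [ar rb mab]]] t /andP[rt tr]; apply: (C1Mat_isCM _ _ mab).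
  exact: open_oo.
by rewrite /= (lt_le_trans ar)//= (le_lt_trans tr).
Qed.

(** By uniqueness, the curve selected in the definition of [evol] may be
    replaced by any other one. *)
Lemma evolE (r r' : R) phi mu : r <= r' -> has_rlogder r r' phi mu ->
  evol r r' phi = (mu r' * (mu r)^-1)%g.
Proof.
move=> rr' muphi; apply: xget_unique; first by exists mu.
move=> _ [nu nuphi ->]; apply: rlogder_eq_evol => // t tr; split.
- exact: curveG_C1Mat nuphi.1 t tr.
- exact: curveG_C1Mat muphi.1 t tr.
by rewrite -(muphi.2 t tr) -(nuphi.2 t tr).
Qed.

Lemma evol_zero (r r' : R) phi : r <= r' ->
  (forall t : R, r <= t <= r' -> phi t = 0) -> evol r r' phi = 1%g.
Proof.
move=> rr' phi0; rewrite (@evolE r r' phi (fun=> 1%g))//; first by rewrite mulgV.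
have c1 (t : R^o) : C1Mat (fun=> 1%g : G) t by exact: C1Mat_cst.
split=> [|t tr].
  exists (r - 1), (r' + 1); split; [by rewrite ltrBlDr ltrDl|by rewrite ltrDl|].
  by apply: isCM_C1Mat => //; exact: open_oo.
apply: (can_inj (@dXiK _ _ _ Xi)); rewrite phi0// dXi0; apply/esym.
apply: rlogder_unique; first exact: c1.
have h : cst (0 : E) s @[s --> (0 : R)^'] --> (0 : E) by exact: cvg_cst.
by apply: cvg_trans h; apply: near_eq_cvg; apply: nearW => s; rewrite /diffquot subrr scaler0.
Qed.

Lemma rlogder_aff mu (al c : R) (t : R^o) : c != 0 -> C1Mat mu (al + c * t : R^o) ->
  rlogder (fun s : R^o => mu (al + c * s : R^o)) t =
  c *: (rlogder mu (al + c * t : R^o) : g) :> g.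
Proof.
move=> c0 mt; apply: (can_inj (@dXiK _ _ _ Xi)); rewrite dXiZ.
apply: rlogder_unique.
  apply: (C1Mat_comp (f := mu) (u := fun s : R^o => al + c * s : R^o)) => //.
  exact: C1at_aff.
pose f (s : R^o) : E := Xi (mu (al + c * t + s : R^o) * (mu (al + c * t : R^o))^-1)%g.
have h : has_dirderiv f (0 + c * 0 : R^o) 1 (dXi (rlogder mu (al + c * t : R^o) : g)).
  by rewrite mulr0 add0r; exact: has_rlogder_chart.
have := has_dirderiv_aff (d := 1) c0 h; rewrite mul1r.
congr (has_dirderiv _ _ _ _); apply/funext => s.
by rewrite scale1r add0r /f mulrDr addrA.
Qed.

Lemma aff_interval (a b al c s : R) : 0 < c ->
  ((a - al) / c < s < (b - al) / c) = (a < al + c * s < b).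
Proof.
move=> c0; rewrite ltr_pdivrMr// ltr_pdivlMr// [s * c]mulrC.
by rewrite ltrBlDl ltrBrDl.
Qed.

Lemma has_rlogder_aff (r r' : R) phi mu (al c : R) : 0 < c ->
  (forall t : R, r <= t <= r' -> r <= al + c * t <= r') ->
  r <= r' -> has_rlogder r r' phi mu ->
  has_rlogder r r' (fun t : R^o => c *: phi (al + c * t : R^o))
    (fun t : R^o => mu (al + c * t : R^o)).
Proof.
move=> c0 acr rr' [muC muphi]; split; last first.
  move=> t tr; rewrite rlogder_aff ?gt_eqF// ?muphi//; first exact: acr.
  exact: (curveG_C1Mat muC (acr t tr)).
have [a [b [ar rb mab]]] := muC.
have rr : r <= r <= r' by rewrite lexx.
have rr1 : r <= r' <= r' by rewrite lexx rr'.
exists ((a - al) / c), ((b - al) / c); split.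
- rewrite ltr_pdivrMr// ltrBlDl [r * c]mulrC.
  by apply: (lt_le_trans ar); case/andP: (acr r rr).
- rewrite ltr_pdivlMr// ltrBrDl [r' * c]mulrC.
  by apply: (le_lt_trans _ rb); case/andP: (acr r' rr1).
apply: isCM_C1Mat; first exact: open_oo.
move=> s /=; rewrite aff_interval// => sab.
apply: (C1Mat_comp (f := mu) (u := fun s : R^o => al + c * s : R^o)).
  by apply: (C1Mat_isCM _ _ mab) => //; exact: open_oo.
exact: C1at_aff.
Qed.

Lemma isC_interval_aff k (r r' : R) phi psi (a b al c d : R) : 0 < c -> d != 0 ->
  (forall t : R, r <= t <= r' -> r <= al + c * t <= r') -> r <= r' ->
  a < r -> r' < b -> isC k [set s : R^o | a < s < b] psi ->
  (forall t, r <= t <= r' -> phi t = psi t) ->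
  [/\ (a - al) / c < r, r' < (b - al) / c,
    isC k [set s : R^o | (a - al) / c < s < (b - al) / c]
      (fun t : R^o => d *: psi (al + c * t : R^o)) &
    forall t, r <= t <= r' -> d *: phi (al + c * t : R^o) = d *: psi (al + c * t : R^o)].
Proof.
move=> c0 d0 acr rr' ar rb psiC phipsi.
have rr : r <= r <= r' by rewrite lexx.
have rr1 : r <= r' <= r' by rewrite lexx rr'.
split.
- rewrite ltr_pdivrMr// ltrBlDl [r * c]mulrC.
  by apply: (lt_le_trans ar); case/andP: (acr r rr).
- rewrite ltr_pdivlMr// ltrBrDl [r' * c]mulrC.
  by apply: (le_lt_trans _ rb); case/andP: (acr r' rr1).
- have -> : [set s : R^o | (a - al) / c < s < (b - al) / c] =
      (fun s : R^o => al + c * s : R^o) @^-1` [set s : R^o | a < s < b].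
    by apply/seteqP; split => s /=; rewrite aff_interval.
  by apply: isC_aff => //; [exact: lieAlg_hausdorff|rewrite gt_eqF].
- by move=> t tr; rewrite phipsi//; exact: acr.
Qed.

Lemma curveC_aff k (r r' : R) phi (al c d : R) : 0 < c -> d != 0 ->
  (forall t : R, r <= t <= r' -> r <= al + c * t <= r') -> r <= r' ->
  curveC k r r' phi -> curveC k r r' (fun t : R^o => d *: phi (al + c * t : R^o)).
Proof.
move=> c0 d0 acr rr'; case: k => [n||] /=.
- move=> [a [b [psi [ar rb psiC phipsi]]]].
  have [a1 b1 h1 h2] := isC_interval_aff c0 d0 acr rr' ar rb psiC phipsi.
  by do 3!eexists; split; [exact: a1|exact: b1|exact: h1|exact: h2].
- move=> lip p pc; have [L L0 Lp] := lip p pc; have [_ pZ _] := pc.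
  exists (`|d| * (L * `|c|)); first by rewrite !mulr_ge0.
  move=> t t' tr tr'; rewrite -scalerBr dXiZ pZ -!mulrA ler_wpM2l//.
  apply: (le_trans (Lp _ _ (acr _ tr) (acr _ tr'))).
  by rewrite ler_wpM2l// -normrM mulrBr opprD addrACA subrr add0r.
- move=> [a [b [psi [ar rb psiC phipsi]]]].
  have h k := isC_interval_aff c0 d0 acr rr' ar rb (psiC k) phipsi.
  have [a1 b1 _ h2] := h 0%N.
  do 3!eexists; split; [exact: a1|exact: b1| |exact: h2].
  by move=> k; have [_ _ ? _] := h k.
Qed.

End Evolution.

(** * Uniform smallness of evolutions *)

Section Segments.
Context {R : realType}.

(** The compactness argument behind all the uniform estimates. *)
Lemma segment_uniform_near (I : Type) (F : set_system I) (P : I -> R -> Prop)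
    (a b : R) : Filter F ->
  (forall t : R, a <= t <= b -> \forall s \near t & i \near F, P i s) ->
  \forall i \near F, forall t : R, a <= t <= b -> P i t.
Proof.
move=> FF h.
have cK : compact [set t : R | a <= t <= b].
  have -> : [set t : R | a <= t <= b] = [set` `[a, b]].
    by apply/seteqP; split => t; rewrite /= in_itv.
  exact: segment_compact.
exact: (compact_near_coveringP _).1 cK I F P FF h.
Qed.

Lemma continuous_segment_bounded (f : R^o -> R) (r r' : R) :
  (forall t : R, r <= t <= r' -> {for (t : R^o), continuous f}) ->
  exists2 M : R, 0 <= M & forall t : R, r <= t <= r' -> f t <= M.
Proof.
move=> fc.
have [|M0 [_ h]] := @segment_uniform_near R (+oo)%R (fun M t => f t <= M) r r' _.
  move=> t /fc ft.
  have fb : \forall s \near t, f s <= f t + 1.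
    have fb1 : \forall s \near t, `|f t - f s| < 1.
      exact: (ft _ (nbhsx_ballx (f t) 1 ltr01)).
    by apply: filterS fb1 => s /ltr_distlCDr /ltW.
  exists ([set s | f s <= f t + 1], [set M | f t + 1 <= M]) => /=.
    by split => //; apply: nbhs_pinfty_ge; rewrite num_real.
  by move=> [s M] /= [/le_trans]; exact.
exists (`|M0| + 1); first by rewrite addr_ge0.
move=> t tr; apply: h => //.
by rewrite (le_lt_trans (ler_norm _))// ltrDl.
Qed.

End Segments.

Section UniformSmallness.
Context {R : realType} {E : tvsType R} {G : lieGroup E} (Xi : unitChart G).
Local Notation g := (lieAlg Xi).
Implicit Types (phi psi : R^o -> g) (mu nu : R^o -> G).

Lemma segment_dnbhs_proper (r r' t : R) : r < r' -> r <= t <= r' ->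
  ProperFilter (within [set s : R | r <= s <= r'] (t : R^o)^').
Proof.
move=> rr' /andP[rt tr]; apply: Build_ProperFilter => /nbhs_ballP[e /= e0 h].
have [tlt|tge] := ltP t r'.
  pose s := Num.min (t + e / 2) r'.
  have ts : t < s by rewrite lt_min tlt ltrDl divr_gt0.
  apply: (h s); rewrite /ball /= ?gt_eqF//.
    rewrite ltr0_norm ?subr_lt0// opprB ltrBlDl gt_min ltrD2l.
    by rewrite ltr_pdivrMr// ltr_pMr// ltr1n.
  by apply/andP; split; [exact: le_trans rt (ltW ts)|rewrite ge_min lexx orbT].
pose s := Num.max (t - e / 2) r.
have st : s < t by rewrite gt_max ltrBlDr ltrDl divr_gt0//= (lt_le_trans rr').
apply: (h s); rewrite /ball /= ?lt_eqF//.
  rewrite gtr0_norm ?subr_gt0// ltrBlDl -ltrBlDr lt_max ltrD2l ltrN2.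
  by rewrite ltr_pdivrMr// ltr_pMr// ltr1n.
by apply/andP; split; [rewrite le_max lexx orbT|exact: le_trans (ltW st) tr].
Qed.

(** The one-sided derivatives at the end points are unique because the segment
    accumulates at each of its points. *)
Lemma derive_onE (r r' t : R) phi psi w : r < r' -> r <= t <= r' ->
  (forall s : R, r <= s <= r' -> phi s = psi s) ->
  has_dirderiv psi (t : R^o) 1 w -> derive_on r r' phi t = w.
Proof.
move=> rr' tr phipsi pw.
have pf := segment_dnbhs_proper rr' tr.
have lim : (s - t)^-1 *: (phi s - phi t)
    @[s --> within [set s : R^o | r <= s <= r'] (t : R^o)^'] --> w.
  have st : s - t @[s --> within [set s : R^o | r <= s <= r'] (t : R^o)^'] --> (0 : R^o)^'.
    move=> B /nbhs_ballP[e /= e0 eB]; apply/nbhs_ballP; exists e => //= s ts s0 _.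
    apply: eB; last by rewrite subr_eq0.
    by move: ts; rewrite /ball /= sub0r normrN distrC.
  have := cvg_comp _ _ st pw; apply: cvg_trans; apply: near_eq_cvg.
  rewrite near_withinE; apply: nearW => s /= sr.
  by rewrite /diffquot -[_ *: 1]/(_ * 1) mulr1 [t + _]addrC subrK !phipsi.
apply: xget_unique => // w' w'lim.
exact: (cvg_unique (@lieAlg_hausdorff _ _ _ Xi) w'lim lim).
Qed.

Lemma iter_derive_onE n (r r' a b : R) phi psi : r < r' -> a < r -> r' < b ->
  isC n [set s : R^o | a < s < b] psi ->
  (forall s : R, r <= s <= r' -> phi s = psi s) ->
  forall m (t : R), (m <= n)%N -> r <= t <= r' ->
  iter m (derive_on r r') phi t = dirderivs (nseq m (1 : R^o)) psi t.
Proof.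
move=> rr' ar rb psiC phipsi; elim=> [|m IH] t mn tr; first exact: phipsi.
have tab : a < t < b by case/andP: tr => rt tr; rewrite (lt_le_trans ar)//= (le_lt_trans tr).
have -> : nseq m.+1 (1 : R^o) = rcons (nseq m 1) 1 by elim: m {IH mn} => //= m ->.
rewrite /dirderivs foldl_rcons /=; apply: (@derive_onE r r' t (iter m (derive_on r r') phi) (dirderivs (nseq m (1 : R^o)) psi)) => //.
  by move=> s sr; apply: IH => //; exact: ltnW.
by apply: dirderivP; apply: psiC.1 => //; rewrite size_nseq.
Qed.

(** The iterated derivatives are those of a smooth extension of [phi], hence
    continuous and bounded on the segment; in the Lipschitz case only the order
    zero occurs. The dilation contributes the factors [c ^+ m <= 1]. *)
Lemma derivative_bound k (r r' : R) phi (p : E -> R) (s : nat) : r < r' ->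
  curveC k r r' phi -> order_le s k -> continuous_seminorm p ->
  exists2 M : R, 0 <= M & forall (al c d : R) m (t : R), 0 < c <= 1 -> d != 0 ->
    (forall t : R, r <= t <= r' -> r <= al + c * t <= r') ->
    (m <= s)%N -> r <= t <= r' ->
    p (dXi (iter m (derive_on r r') (fun t : R^o => d *: phi (al + c * t : R^o)) t))
      <= `|d| * M.
Proof.
move=> rr' phiC sk pc; have [pD pZ pcont] := pc.
have smooth : (exists n a b psi, [/\ (s <= n)%N, a < r, r' < b,
      isC n [set s : R^o | a < s < b] psi &
      forall t, r <= t <= r' -> phi t = psi t]) -> exists2 M : R, 0 <= M &
   forall (al c d : R) m (t : R), 0 < c <= 1 -> d != 0 ->
    (forall t : R, r <= t <= r' -> r <= al + c * t <= r') ->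
    (m <= s)%N -> r <= t <= r' ->
    p (dXi (iter m (derive_on r r') (fun t : R^o => d *: phi (al + c * t : R^o)) t))
      <= `|d| * M.
  move=> [n [a [b [psi [sn ar rb psiC phipsi]]]]].
  have bd m : exists M : R, (m <= s)%N -> 0 <= M /\ forall t : R, r <= t <= r' ->
      p (dXi (dirderivs (nseq m (1 : R^o)) psi t)) <= M.
    have [ms|ms] := leqP m s; last by exists 0.
    (* Beyond s the sequence of bounds is filled up with 0. *)
    have [|M M0 MP] := @continuous_segment_bounded R
      (fun t : R^o => p (dXi (dirderivs (nseq m (1 : R^o)) psi t))) r r'; last by exists M.
    move=> t /andP[rt tr]; apply: continuous_comp; last exact: pcont.
    apply: continuous_comp; last exact: dXi_continuous.
    apply: (dirderivs_continuous psiC); first exact: leq_trans sn.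
    by rewrite /= (lt_le_trans ar)//= (le_lt_trans tr).
  have [M MP] := choice bd.
  have M0 (i : 'I_s.+1) : 0 <= M i by have [] := MP i (ltn_ord i).
  exists (\sum_(i < s.+1) M i); first by rewrite sumr_ge0.
  move=> al c d m t /andP[c0 c1] d0 acr ms tr.
  have [a1 b1 h1 h2] := isC_interval_aff c0 d0 acr (ltW rr') ar rb psiC phipsi.
  rewrite (iter_derive_onE rr' a1 b1 h1 h2) ?(leq_trans ms)//.
  rewrite (dirderivs_aff (@lieAlg_hausdorff _ _ _ Xi))//; last by rewrite gt_eqF.
  rewrite dXiZ pZ normrM -mulrA ler_wpM2l//.
  have [Mm0 Mm] := MP m ms.
  apply: (@le_trans _ _ (M m)); last first.
    have ms1 : (m < s.+1)%N by [].
    rewrite (bigD1 (Ordinal ms1))//= lerDl sumr_ge0// => i _; exact: M0.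
  apply: (le_trans _ (Mm _ (acr t tr))); rewrite normrX gtr0_norm//.
  have p0 x : 0 <= p x.
    have := pD x (-1 *: x); have := pZ (-1) x; have := pZ 0 x.
    rewrite normr0 mul0r scale0r normrN1 mul1r scaleN1r subrr => -> ->.
    by rewrite -mulr2n pmulrn_lge0.
  by rewrite ler_piMl// exprn_ile1// ltW.
case: k phiC sk => [n||] /=.
- move=> [a [b [psi [ar rb psiC phipsi]]]] sn; apply: smooth.
  by exists n, a, b, psi.
- move=> lip /eqP s0; have [L L0 Lp] := lip p pc.
  have rr : r <= r <= r' by rewrite lexx ltW.
  exists (`|p (dXi (phi r))| + L * (r' - r)).
    by rewrite addr_ge0// mulr_ge0// subr_ge0 ltW.
  move=> al c d m t _ d0 acr; rewrite s0 leqn0 => /eqP-> tr /=.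
  rewrite dXiZ pZ ler_wpM2l//; set y := al + c * t.
  have yr := acr t tr; have {1}-> : phi y = phi r + (phi y - phi r) by rewrite addrC subrK.
  rewrite dXiD; apply: (le_trans (pD _ _)); apply: lerD; first exact: ler_norm.
  apply: (le_trans (Lp _ _ yr rr)); rewrite ler_wpM2l//.
  by case/andP: yr => ry yr'; rewrite ger0_norm ?subr_ge0// lerD2r.
- move=> [a [b [psi [ar rb psiC phipsi]]]] _; apply: smooth.
  by exists s, a, b, psi; split.
Qed.

(** For [r < t] the contraction is [s |-> al + c * s], the affine map of [[r,
    r']] onto [[r, t]]. *)
Lemma evol_zero_uniform k (r r' delta : R) phi (W : set G) : k_continuous Xi k ->
  r < r' -> curveC k r r' phi -> 0 < delta ->
  (forall h : R, - delta < h < delta -> evol_dom k r r' (fun t => h *: phi t)) ->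
  nbhs 1%g W -> \forall h \near (0 : R)^', forall mu,
    has_rlogder r r' (fun t => h *: phi t) mu ->
    forall t : R, r <= t <= r' -> W (mu t * (mu r)^-1)%g.
Proof.
move=> Gk rr' phiC delta0 phidom W1.
have dom0 : evol_dom k r r' (fun t => 0 *: phi t) by apply: phidom; rewrite oppr_lt0 delta0.
have := Gk r r' rr' _ dom0 W; rewrite evol_zero; [|exact: ltW|by move=> t _; rewrite scale0r].
move=> /(_ W1)[n [p [s [e [e0 ps eW]]]]].
have bd i : exists M : R, 0 <= M /\ forall (al c d : R) m (t : R), 0 < c <= 1 -> d != 0 ->
    (forall t : R, r <= t <= r' -> r <= al + c * t <= r') ->
    (m <= s i)%N -> r <= t <= r' ->
    p i (dXi (iter m (derive_on r r') (fun t : R^o => d *: phi (al + c * t : R^o)) t))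
      <= `|d| * M.
  have [pi si] := ps i.
  by have [M M0 MP] := derivative_bound rr' phiC si pi; exists M.
have [M MP] := choice bd.
(* One constant larger than all the bounds; the leading 1 covers an empty family. *)
pose S := 1 + \sum_(i < n) M i.
have S0 : 0 < S by rewrite ltr_wpDr// sumr_ge0// => i _; case: (MP i).
have MS i : M i < S.
  rewrite /S (bigD1 i)//= addrCA ltrDl ltr_wpDr// sumr_ge0// => j _.
  by case: (MP j).
have eS : 0 < e / S by rewrite divr_gt0.
have hsmall : \forall h \near (0 : R)^', `|h| < Num.min delta (e / S).
  apply: nbhs_dnbhs; apply/nbhs_ballP; exists (Num.min delta (e / S)) => /=.
    by rewrite lt_min delta0.
  by move=> h; rewrite /ball /= sub0r normrN.
apply: filterS2 hsmall (nbhs_dnbhs_neq (0 : R)) => h.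
rewrite lt_min => /andP[hd he] h0 mu muphi t /andP[rt tr].
move: rt; rewrite le_eqVlt => /orP[/eqP<-|rt]; first by rewrite mulgV; exact: nbhs_singleton.
pose c := (t - r) / (r' - r); pose al := r - c * r.
have rr0 : 0 < r' - r by rewrite subr_gt0.
have c0 : 0 < c by rewrite divr_gt0// subr_gt0.
have c1 : c <= 1 by rewrite ler_pdivrMr// mul1r lerD2r.
have alr : al + c * r = r by rewrite /al subrK.
have alr' : al + c * r' = t.
  rewrite /al addrAC -addrA -mulrBr /c divfK ?gt_eqF//.
  by rewrite addrC subrK.
have acr (u : R) : r <= u <= r' -> r <= al + c * u <= r'.
  move=> /andP[ru ur]; apply/andP; split.
    by rewrite -{1}alr lerD2l ler_pM2l.
  by apply: le_trans tr; rewrite -alr' lerD2l ler_pM2l.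
(* The evolution of the contracted curve over the whole segment is the one
   of the original curve from r to t. *)
have nu := has_rlogder_aff c0 acr (ltW rr') muphi.
have hdom : evol_dom k r r' (fun t => h *: phi t) by apply: phidom; rewrite -ltr_norml.
have -> : (mu t * (mu r)^-1)%g =
    evol r r' (fun u : R^o => c *: (h *: phi (al + c * u : R^o))).
  by rewrite (evolE (ltW rr') nu) alr alr'.
apply: (eW (fun u : R^o => c *: (h *: phi (al + c * u : R^o)))); last first.
  split; last by exists (fun u : R^o => mu (al + c * u : R^o)).
  by apply: (curveC_aff (phi := fun t => h *: phi t)) => //; [rewrite gt_eqF|exact: ltW|exact: hdom.1].
move=> i; have [M0 MP'] := MP i.
have -> : (fun u : R^o => c *: (h *: phi (al + c * u : R^o)) - 0 *: phi u) =
    (fun u : R^o => (c * h) *: phi (al + c * u : R^o)).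
  by apply/funext => u; rewrite scale0r subr0 scalerA.
apply: (@le_lt_trans _ _ (`|c * h| * M i)).
  apply: ge_sup.
    exists (p i (dXi (iter 0 (derive_on r r') (fun u : R^o => (c * h) *: phi (al + c * u : R^o)) r))).
    by exists 0%N, r; split => //; rewrite lexx ltW.
  move=> _ [m [u [ms ur ->]]]; apply: MP' => //; first by rewrite c0.
  by rewrite mulf_neq0// gt_eqF.
rewrite normrM gtr0_norm//.
have : c * `|h| <= `|h| by rewrite ler_piMl.
move/(ler_wpM2r M0)/le_lt_trans; apply.
apply: (@le_lt_trans _ _ (`|h| * S)); first by rewrite ler_wpM2l// ltW.
by rewrite -ltr_pdivlMr.
Qed.

End UniformSmallness.

(** * Mean value estimates for Riemann sums *)

Section VectorSpace.
Context {R : realType} {E : tvsType R}.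

Lemma cvgB_tvs T (F : set_system T) {FF : Filter F} (f g : T -> E) (x y : E) :
  f @ F --> x -> g @ F --> y -> f t - g t @[t --> F] --> x - y.
Proof.
move=> fx gy; apply: cvgD_tvs => //.
have -> : (fun t => - g t) = (fun t => -1 *: g t) by apply/funext => t; rewrite scaleN1r.
have k : cst (-1 : R) t @[t --> F] --> (-1 : R) by exact: cvg_cst.
by rewrite -[- y]scaleN1r; exact: (cvgZ_tvs k gy).
Qed.

Lemma nbhs0_scaled (a : R) (N : set E) : nbhs 0 N -> nbhs 0 [set x | N (a *: x)].
Proof.
move=> N0; have h : a *: x @[x --> (0 : E)] --> (0 : E).
  rewrite -[X in _ --> X](scaler0 E a).
  by apply: cvgZ_tvs; [exact: cvg_cst|exact: cvg_id].
exact: (h N N0).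
Qed.

Lemma nbhs0_split_add (N : set E) : nbhs 0 N ->
  exists2 M, nbhs 0 M & forall x y, M x -> M y -> N (x + y).
Proof.
move=> N0; have := @add_continuous E (0, 0); rewrite /prop_for /continuous_at /= addr0.
move=> /(_ N N0) [[A B] /= [A0 B0] AB]; exists (A `&` B); first exact: filterI.
by move=> x y [Ax _] [_ By]; exact: (AB (x, y)).
Qed.

Lemma nbhs0_split_sub (N : set E) : nbhs 0 N ->
  exists2 M, nbhs 0 M & forall x y, M x -> M y -> N (x - y).
Proof.
move=> /nbhs0_split_add[M M0 MN]; exists (M `&` [set x | M (-1 *: x)]).
  by apply: filterI => //; exact: nbhs0_scaled.
by move=> x y [Mx _] [_ My]; apply: MN => //; rewrite -scaleN1r.
Qed.

Variables (X : R^o -> E) (a b : R).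
Hypothesis Xc : forall t : R, a <= t <= b -> {for (t : R^o), continuous X}.

Lemma segment_unif_continuous (N : set E) : nbhs 0 N ->
  exists2 d : R, 0 < d & forall s t : R, a <= s <= b -> a <= t <= b ->
    `|s - t| < d -> N (X s - X t).
Proof.
move=> /nbhs0_split_sub[M M0 MN].
have : \forall d \near (0 : R)^'+, forall t : R, a <= t <= b ->
    forall s : R, a <= s <= b -> `|s - t| < d -> N (X s - X t).
  apply: segment_uniform_near => t0 t0ab.
  have Xt0 : \forall s \near t0, M (X s - X t0).
    have h : X s - X t0 @[s --> (t0 : R^o)] --> (0 : E).
      rewrite -(subrr (X t0)); apply: cvgD_tvs; first exact: Xc.
      exact: cvg_cst.
    exact: (h M M0).
  have /nbhs_ballP[e /= e0 eM] := Xt0.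
  exists (ball t0 (e / 2), [set d | d < e / 2]) => /=.
    split; first by apply: nbhsx_ballx; rewrite divr_gt0.
    by apply: nbhs_right_lt; rewrite divr_gt0.
  move=> [t d] /= [t0t de] s sab std.
  have -> : X s - X t = (X s - X t0) - (X t - X t0) by rewrite opprB addrA subrK.
  apply: MN; apply: eM; move: t0t std; rewrite /ball /= !ltr_norml.
    by move=> /andP[? ?] /andP[? ?]; apply/andP; split; lra.
  by move=> /andP[? ?] /andP[? ?]; apply/andP; split; lra.
move=> h; have [d [dP d0]] := filter_ex (filterI h (nbhs_right_gt (0 : R))).
by exists d => // s t sab tab; exact: dP.
Qed.

Lemma line_increment (f f' v : E) (s t : R) :
  f' - (s + t) *: v - (f - s *: v) = f' - f - t *: v.
Proof.
rewrite opprB [s *: v - f]addrC addrACA; congr (_ + _).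
by rewrite scalerDl opprD addrAC addNr add0r.
Qed.

(** The sets [al *: C] add up for nonnegative [al], including [al = 0], which
    occurs for the degenerate intervals of a partition. *)
Lemma convex_scaledD (C : set E) (al be : R) v w : convex_set C -> 0 <= al -> 0 <= be ->
  (exists2 z, C z & v = al *: z) -> (exists2 z, C z & w = be *: z) ->
  exists2 z, C z & v + w = (al + be) *: z.
Proof.
move=> cC al0 be0 [z1 Cz1 ->] [z2 Cz2 ->].
have [ab0|abN] := eqVneq (al + be) 0.
  move: (ab0) => /eqP; rewrite paddr_eq0// => /andP[/eqP-> /eqP->].
  by exists z1 => //; rewrite addr0 !scale0r addr0.
exists ((al / (al + be)) *: z1 + (be / (al + be)) *: z2).
  apply: convex_setP => //; rewrite ?divr_ge0 ?addr_ge0//.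
  by rewrite -mulrDl divff.
by rewrite scalerDr !scalerA ![(al + be) * _]mulrC !divfK.
Qed.

Lemma tagged_partition_le (d : R) n (x xi : nat -> R) : tagged_partition a b d n x xi ->
  forall i j, (i <= j)%N -> (j <= n)%N -> x i <= x j.
Proof.
move=> [_ _ xP] i j; elim: j => [|j IH]; first by rewrite leqn0 => /eqP->.
rewrite leq_eqVlt => /orP[/eqP->//|ij] jn.
have [xi1 xi2 _] := xP j jn.
by apply: (le_trans (IH ij (ltnW jn))); exact: le_trans xi1 xi2.
Qed.

(** On each interval of the partition the mean value theorem is applied to [s
    |-> u s - s *: X (xi i)]; the resulting errors add up by convexity of [C].
    *)
Lemma riemann_sum_mean_value (C : set E) (d : R) (u : R^o -> E) n (x xi : nat -> R) :
  convex_set C -> open C -> C 0 -> tagged_partition a b d n x xi ->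
  (forall s t : R, a <= s <= b -> a <= t <= b -> `|s - t| < d ->
     exists2 w, C (w - X t) & has_dirderiv u (s : R^o) 1 w) ->
  exists2 z, C z &
    u b - u a - \sum_(i < n) (x i.+1 - x i) *: X (xi i) = (b - a) *: z.
Proof.
move=> cC oC C0 part uC; have [x0 xn xP] := part.
have xmono := tagged_partition_le part.
have step (i : nat) : (i < n)%N ->
    exists2 z, C z & u (x i.+1) - u (x i) - (x i.+1 - x i) *: X (xi i) = (x i.+1 - x i) *: z.
  move=> iN; have [xi1 xi2 xid] := xP i iN.
  have [xx|xx] := eqVneq (x i) (x i.+1).
    by exists 0 => //; rewrite xx !subrr !scale0r subr0.
  have xlt : x i < x i.+1 by rewrite lt_neqAle xx (le_trans xi1).
  have ax : a <= x i by rewrite -x0; apply: xmono => //; exact: ltnW.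
  have xb : x i.+1 <= b by rewrite -xn; exact: xmono.
  pose v (s : R^o) : E := u s - s *: X (xi i).
  exists ((x i.+1 - x i)^-1 *: (v (x i.+1) - v (x i))).
    apply: (@mean_value_on _ _ C v) => // s /andP[s1 s2].
    have [|||w Cw uw] := uC s (xi i).
    - by rewrite (le_trans ax)//= (le_trans s2).
    - by rewrite (le_trans ax)//= (le_trans xi2).
    - rewrite ltr_norml; apply/andP; split; lra.
    exists (w - X (xi i)) => //.
    have h : diffquot u (s : R^o) 1 t - X (xi i) @[t --> (0 : R)^'] --> w - X (xi i).
      by apply: cvgD_tvs => //; exact: cvg_cst.
    apply: cvg_trans h; apply: near_eq_cvg.
    apply: filterS (nbhs_dnbhs_neq (0 : R)) => t t0.
    rewrite /diffquot /v -[t *: 1]/(t * 1) mulr1 line_increment.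
    by rewrite [RHS]scalerBr scalerA mulVf// scale1r.
  rewrite scalerA divff ?subr_eq0 1?eq_sym// scale1r /v.
  by rewrite -(line_increment _ _ _ (x i)) [x i + _]addrC subrK.
have sumP (j : nat) : (j <= n)%N -> exists2 z, C z &
    u (x j) - u (x 0%N) - \sum_(i < j) (x i.+1 - x i) *: X (xi i) = (x j - x 0%N) *: z.
  elim: j => [|j IH] jn.
    by exists 0 => //; rewrite big_ord0 !subrr scale0r.
  have h := convex_scaledD cC _ _ (IH (ltnW jn)) (step j jn).
  have [||z Cz hz] := h.
  - by rewrite subr_ge0; apply: xmono => //; exact: ltnW.
  - by rewrite subr_ge0; exact: xmono.
  exists z => //; rewrite big_ord_recr /=.
  have -> : x j.+1 - x 0%N = (x j - x 0%N) + (x j.+1 - x j) by rewrite [RHS]addrC addrA subrK.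
  by rewrite -hz [RHS]addrACA -opprD; congr (_ - _); rewrite [RHS]addrC addrA subrK.
by have := sumP n (leqnn n); rewrite x0 xn.
Qed.

End VectorSpace.

(** * The difference quotient in the chart *)

Section DerivativeAtZero.
Context {R : realType} {E : tvsType R} {G : lieGroup E} (Xi : unitChart G).
Local Notation g := (lieAlg Xi).
Implicit Types (phi psi : R^o -> g) (mu nu : R^o -> G).

Lemma chart_field_near_id (X : R^o -> E) (a b : R) (N : set E) :
  (forall t : R, a <= t <= b -> {for (t : R^o), continuous X}) -> nbhs 0 N ->
  \forall y \near (0 : E), forall t : R, a <= t <= b ->
    N (chart_field Xi y (X t) - X t).
Proof.
move=> Xc N0; apply: segment_uniform_near => t tab.
have h : chart_field Xi z.2 (X z.1) - X z.1 @[z --> ((t, 0) : R^o * E)] -->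
    chart_field Xi 0 (X t) - X t.
  have X1 : X z.1 @[z --> ((t, 0) : R^o * E)] --> X t.
    exact: (cvg_comp _ _ (@cvg_fst _ _ (nbhs (t : R^o)) (nbhs (0 : E)) _) (Xc t tab)).
  apply: cvgB_tvs => //.
  have X2 : (z.2, X z.1) @[z --> ((t, 0) : R^o * E)] --> ((0, X t) : E * E).
    apply: (@cvg_pair _ _ _ _ (nbhs (0 : E)) (nbhs (X t))) => //.
    exact: (@cvg_snd _ _ (nbhs (t : R^o)) (nbhs (0 : E)) _).
  exact: (cvg_comp _ _ X2 (chart_field_continuous (v := X t) (@uchart_cod0 _ _ _ Xi))).
rewrite chart_field0 subrr in h; exact: (h N N0).
Qed.

(** The unknown curves are small uniformly in time by [evol_zero_uniform], so
    the field along them is close to its value at the unit. *)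
Lemma evol_chart_curves k (r r' delta : R) phi (X : R^o -> E) (N : set E) :
  k_continuous Xi k -> r < r' -> curveC k r r' phi -> 0 < delta ->
  (forall h : R, - delta < h < delta -> evol_dom k r r' (fun t => h *: phi t)) ->
  (forall t : R, r <= t <= r' -> {for (t : R^o), continuous X}) ->
  (forall t : R, r <= t <= r' -> X t = dXi (phi t)) -> nbhs 0 N ->
  \forall h \near (0 : R)^', cdom Xi (evol r r' (fun t => h *: phi t)) /\
    exists gamma : R^o -> E, [/\ gamma r = 0,
      gamma r' = h^-1 *: Xi (evol r r' (fun t => h *: phi t)) &
      forall t : R, r <= t <= r' ->
        exists2 w, N (w - X t) & has_dirderiv gamma (t : R^o) 1 w].
Proof.
move=> Gk rr' phiC delta0 phidom Xc Xphi N0.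
(* The neighbourhood of the unit on which the field differs from the
   identity by elements of N, uniformly along X. *)
pose W := cdom Xi `&` Xi @^-1` [set y | forall t : R, r <= t <= r' ->
    N (chart_field Xi y (X t) - X t)].
have dom1 := @uchart_dom1 _ _ _ Xi.
have W1 : nbhs 1%g W.
  apply: filterI; first by apply: open_nbhs_nbhs; split => //; exact: cdom_open.
  apply: (cmap_continuous dom1); rewrite uchart1.
  exact: chart_field_near_id Xc N0.
have hdelta : \forall h \near (0 : R)^', - delta < h < delta.
  apply: nbhs_dnbhs; apply/nbhs_ballP; exists delta => //= h.
  by rewrite /ball /= sub0r normrN ltr_norml.
have small := evol_zero_uniform Gk rr' phiC delta0 phidom W1.
apply: filterS3 hdelta small (nbhs_dnbhs_neq (0 : R)) => h hd hW h0.
have [_ [mu muphi]] := phidom h hd; have {}hW := hW mu muphi.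
have rr1 : r <= r' <= r' by rewrite lexx ltW.
rewrite (evolE (ltW rr') muphi); split; first by have [] := hW r' rr1.
exists (fun t => h^-1 *: Xi (mu t * (mu r)^-1)%g); split => //.
  by rewrite mulgV uchart1 scaler0.
move=> t tr; have [cdt Nt] := hW t tr; have mt := curveG_C1Mat muphi.1 tr.
exists (chart_field Xi (Xi (mu t * (mu r)^-1)%g) (X t)); first exact: Nt.
have hE := chart_equation mt cdt.
rewrite -(muphi.2 t tr) dXiZ -Xphi// chart_fieldZ// in hE; last exact: cmap_cod.
have h1 : cst h^-1 s @[s --> (0 : R)^'] --> h^-1 by exact: cvg_cst.
set f := (fun s : R^o => Xi (mu s * (mu r)^-1)%g) in hE.
set w := chart_field _ _ _ in hE *.
have h2 : h^-1 *: diffquot f (t : R^o) 1 s @[s --> (0 : R)^'] --> h^-1 *: (h *: w).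
  exact: (cvgZ_tvs h1 hE).
rewrite scalerA mulVf// scale1r in h2.
apply: cvg_trans h2; apply: near_eq_cvg; apply: nearW => s.
by rewrite /diffquot -scalerBr !scalerA mulrC.
Qed.

End DerivativeAtZero.

Section Completion.
Context {R : realType}.

Lemma cpl_inj_continuous (V : tvsType R) (W : completion V) : continuous (cpl_inj W).
Proof. by move=> x A xA; apply/(cpl_embedding W); exists A. Qed.

Context {E : tvsType R} {G : lieGroup E} (Xi : unitChart G).
Context (gbar : completion (lieAlg Xi)).

Definition cpl_of_model (w : E) : gbar := cpl_inj gbar (dXi_inv Xi w).

Lemma dXi_invD (v w : E) : dXi_inv Xi (v + w) = dXi_inv Xi v + dXi_inv Xi w.
Proof. by apply: (can_inj (@dXiK _ _ _ Xi)); rewrite dXiD !dXi_invK. Qed.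

Lemma dXi_invZ (a : R) (w : E) : dXi_inv Xi (a *: w) = a *: dXi_inv Xi w.
Proof. by apply: (can_inj (@dXiK _ _ _ Xi)); rewrite dXiZ !dXi_invK. Qed.

Lemma cpl_of_modelD v w : cpl_of_model (v + w) = cpl_of_model v + cpl_of_model w.
Proof. by rewrite /cpl_of_model dXi_invD linearD. Qed.

Lemma cpl_of_modelZ (a : R) w : cpl_of_model (a *: w) = a *: cpl_of_model w.
Proof. by rewrite /cpl_of_model dXi_invZ linearZ. Qed.

Lemma cpl_of_model0 : cpl_of_model 0 = 0.
Proof. by have := cpl_of_modelZ 0 0; rewrite !scale0r. Qed.

Lemma cpl_of_modelB v w : cpl_of_model (v - w) = cpl_of_model v - cpl_of_model w.
Proof. by rewrite cpl_of_modelD -scaleN1r cpl_of_modelZ scaleN1r. Qed.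

Lemma cpl_of_model_nbhs0 (W : set gbar) : nbhs 0 W -> nbhs 0 (cpl_of_model @^-1` W).
Proof.
move=> W0; have h : dXi_inv Xi w @[w --> (0 : E)] --> (dXi_inv Xi 0 : lieAlg Xi).
  apply: cvg_dXi; rewrite dXi_invK.
  have dX : dXi (dXi_inv Xi w) @[w --> (0 : E)] --> (0 : E).
    by under eq_fun do rewrite dXi_invK; exact: cvg_id.
  exact: dX.
have := cvg_comp _ _ h (@cpl_inj_continuous _ gbar (dXi_inv Xi 0)).
by apply; rewrite -/(cpl_of_model 0) cpl_of_model0.
Qed.

Lemma cpl_of_model_sum (x xi : nat -> R) (phi : R -> lieAlg Xi) n :
  \sum_(i < n) (x i.+1 - x i) *: cpl_inj gbar (phi (xi i)) =
  cpl_of_model (\sum_(i < n) (x i.+1 - x i) *: dXi (phi (xi i))).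
Proof.
rewrite (big_morph _ cpl_of_modelD cpl_of_model0); apply: eq_bigr => i _.
by rewrite cpl_of_modelZ /cpl_of_model dXiK.
Qed.

End Completion.

(** * Existence of the derivative *)

Section Limit.
Context {R : realType} {E : tvsType R} {G : lieGroup E} (Xi : unitChart G).
Context (k : regularity) (r r' delta : R) (phi : R^o -> lieAlg Xi).
Hypothesis Gk : k_continuous Xi k.
Hypothesis rr' : r < r'.
Hypothesis phiC : curveC k r r' phi.
Hypothesis delta0 : 0 < delta.
Hypothesis phidom : forall h : R, - delta < h < delta ->
  evol_dom k r r' (fun t => h *: phi t).
Local Notation D h := (h^-1 *: Xi (evol r r' (fun t => h *: phi t)) : E).

(** Beyond the end points [phi] is continued by a multiple of a logarithmic
    derivative, so that two-sided limits make sense there. *)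
Lemma evol_dom_continuous_extension : exists X : R^o -> E,
  (forall t : R, r <= t <= r' -> {for (t : R^o), continuous X}) /\
  (forall t : R, r <= t <= r' -> X t = dXi (phi t)).
Proof.
have [|_ [mu [muC muphi]]] := @phidom (delta / 2).
  rewrite ltr_pdivrMr// ltr_pMr// ltr1n andbT.
  by apply: (@lt_trans _ _ 0); [rewrite oppr_lt0|rewrite divr_gt0].
have d0 : delta / 2 != 0 by rewrite gt_eqF// divr_gt0.
exists (fun t => (delta / 2)^-1 *: dXi (rlogder mu t : lieAlg Xi)); split=> t tr.
  apply: cvgZ_tvs; first exact: cvg_cst.
  exact: rlogder_continuous (curveG_C1Mat muC tr).
by rewrite -(muphi t tr) dXiZ scalerA mulVf// scale1r.
Qed.

(** Comparison of two solutions: their quotients have derivatives close to the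
    same curve [X], and the mean value theorem applies to the difference. *)
Lemma quotients_cauchy (N : set E) : nbhs 0 N ->
  exists2 P : set R, (0 : R)^' P & forall h h' : R, P h -> P h' -> N (D h - D h').
Proof.
move=> N0; have [X [Xc Xphi]] := evol_dom_continuous_extension.
have [C [cC oC C0 CN]] := tvs_convex_nbhs (nbhs0_scaled (r' - r) N0).
have [M M0 MC] := nbhs0_split_sub (open_nbhs_nbhs (conj oC C0)).
eexists; first exact: (evol_chart_curves Gk rr' phiC delta0 phidom Xc Xphi M0).
move=> h h' [_ [u [u0 u1 uM]]] [_ [u' [u'0 u'1 u'M]]].
pose v (t : R^o) := u t - u' t.
have vC : C ((r' - r)^-1 *: (v r' - v r)).
  apply: (@mean_value_on _ _ C v) => // t tr.
  have [w Mw uw] := uM t tr; have [w' Mw' u'w] := u'M t tr.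
  exists (w - w').
    have -> : w - w' = (w - X t) - (w' - X t) by rewrite opprB addrA subrK.
    exact: MC.
  have vw : diffquot u (t : R^o) 1 s - diffquot u' (t : R^o) 1 s @[s --> (0 : R)^']
      --> w - w' by exact: (cvgB_tvs uw u'w).
  apply: cvg_trans vw; apply: near_eq_cvg; apply: nearW => s.
  by rewrite /diffquot /v -scalerBr !opprD !opprK addrACA.
have := CN _ vC; rewrite /= scalerA divff ?subr_eq0 ?gt_eqF// scale1r.
by rewrite /v u0 u'0 subrr subr0 u1 u'1.
Qed.

Lemma riemann_quotient_near (N : set E) : nbhs 0 N ->
  \forall h \near (0 : R)^', exists2 d : R, 0 < d &
    forall n x xi, tagged_partition r r' d n x xi ->
      N (D h - \sum_(i < n) (x i.+1 - x i) *: dXi (phi (xi i))).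
Proof.
move=> N0; have [X [Xc Xphi]] := evol_dom_continuous_extension.
have [C [cC oC C0 CN]] := tvs_convex_nbhs (nbhs0_scaled (r' - r) N0).
have [M M0 MC] := nbhs0_split_add (open_nbhs_nbhs (conj oC C0)).
have near0 := evol_chart_curves Gk rr' phiC delta0 phidom Xc Xphi M0.
have [d d0 dM] := segment_unif_continuous Xc M0.
apply: filterS near0 => h [_ [u [u0 u1 uM]]]; exists d => // n x xi part.
have [|z Cz] := @riemann_sum_mean_value _ _ X r r' C d u n x xi cC oC C0 part.
  move=> s t sr tr st; have [w Mw uw] := uM s sr; exists w => //.
  have -> : w - X t = (w - X s) + (X s - X t) by rewrite addrA subrK.
  by apply: MC => //; exact: dM.
rewrite u0 u1 subr0 => zE; have <- : \sum_(i < n) (x i.+1 - x i) *: X (xi i) =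
    \sum_(i < n) (x i.+1 - x i) *: dXi (phi (xi i)).
  apply: eq_bigr => i _; rewrite Xphi//; have [x0 xn xP] := part.
  have [xi1 xi2 _] := xP i (ltn_ord i); have xmono := tagged_partition_le part.
  rewrite -{1}x0 -xn (le_trans _ xi1) ?(le_trans xi2)//; apply: xmono => //.
  exact: ltnW.
by rewrite zE; exact: CN.
Qed.

End Limit.

Theorem mainTheorem9 (R : realType) (E : tvsType R) (G : lieGroup E)
    (Xi : unitChart G) (k : regularity)
    (gbar : completion (lieAlg Xi)) (Ebar : completion E)
    (dXibar : gbar -> Ebar) (dXibar_continuous : continuous dXibar)
    (dXibar_extends : forall X : lieAlg Xi,
       dXibar (cpl_inj gbar X) = cpl_inj Ebar (dXi X))
    (Gk : k_continuous Xi k)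
    (r r' : R) (lt_rr' : r < r')
    (phi : R^o -> lieAlg Xi) (phiCk : curveC k r r' phi)
    (delta : R) (delta_gt0 : 0 < delta)
    (phi_dom : forall h : R, - delta < h < delta ->
       evol_dom k r r' (fun t => h *: phi t)) :
  exists Z : gbar,
    is_riemann_integral (fun t => cpl_inj gbar (phi t)) r r' Z /\
    derivative_at_unit dXibar (fun h : R => evol r r' (fun t => h *: phi t)) Z.
Proof.
pose D (h : R) : E := h^-1 *: Xi (evol r r' (fun t => h *: phi t)).
pose u (h : R) : gbar := cpl_of_model gbar (D h).
have cauchy_u : z.1 - z.2 @[z --> (u @ (0 : R)^', u @ (0 : R)^')] --> (0 : gbar).
  move=> W /(cpl_of_model_nbhs0 (gbar := gbar)) W0.
  have [P P0 PW] := quotients_cauchy Gk lt_rr' phiCk delta_gt0 phi_dom W0.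
  exists (u @` P, u @` P) => /=.
    by split; apply: filterS P0 => h Ph; exists h.
  move=> [_ _] [/= [h Ph <-] [h' Ph' <-]].
  by rewrite /u -cpl_of_modelB; exact: PW.
have [Z uZ] := cpl_complete (fmap_proper_filter u _) cauchy_u.
exists Z; split; last split.
- move=> W ZW.
  have [[A B] /= [ZA B0] ABW] : filter_prod (nbhs Z) (nbhs (0 : gbar))
      (fun z => W (z.1 - z.2)).
    have h : z.1 - z.2 @[z --> ((Z, 0) : gbar * gbar)] --> Z.
      rewrite -[X in _ --> X]subr0.
      apply: cvgB_tvs.
        exact: (@cvg_fst _ _ (nbhs Z) (nbhs (0 : gbar)) _).
      exact: (@cvg_snd _ _ (nbhs Z) (nbhs (0 : gbar)) _).
    exact: (h W ZW).
  have near0 := riemann_quotient_near Gk lt_rr' phiCk delta_gt0 phi_dom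
    (cpl_of_model_nbhs0 B0).
  have nearA : \forall h \near (0 : R)^', A (u h) by exact: (uZ _ ZA).
  have [h [Ah [d d0 dB]]] := @filter_ex _ (0 : R)^' _ _ (@filterI _ (0 : R)^' _ _ _ nearA near0).
  exists d => // n x xi part; rewrite (cpl_of_model_sum gbar x xi phi).
  set S := \sum_(i < n) _.
  (* The quotient at a single small h serves to compare the sum with Z. *)
  have -> : cpl_of_model gbar S = u h - cpl_of_model gbar (D h - S).
    by rewrite cpl_of_modelB /u opprB addrC subrK.
  by apply: (ABW (_, _)); split => //; exact: dB.
- by apply: evol_zero; [exact: ltW|move=> t _; rewrite scale0r].
- have [X [Xc Xphi]] := evol_dom_continuous_extension delta_gt0 phi_dom.
  have T0 : nbhs (0 : E) setT by exact: filterT.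
  have near0 := evol_chart_curves Gk lt_rr' phiCk delta_gt0 phi_dom Xc Xphi T0.
  rewrite near_withinE in near0; apply: filterS near0 => h hP.
  have [->|h0] := eqVneq h 0; last by have [] := hP h0.
  rewrite evol_zero; [exact: uchart_dom1|exact: ltW|].
  by move=> t _; rewrite scale0r.
- have := cvg_comp _ _ uZ (dXibar_continuous Z); apply: cvg_trans.
  apply: near_eq_cvg; apply: nearW => h /=.
  by rewrite /u /cpl_of_model dXibar_extends dXi_invK /D linearZ.
Qed.
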